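(* Let $r\in\mathbb{N}$, $n\in\mathbb{N}$, $\alpha\in\mathbb{N}$, $\beta>\frac{n+r+1}{2\alpha}$, let $f\in C^n(\mathbb{R})$ with $f^{(n)}\in L_1(\mathbb{R})$, and let $\xi>0$. Then $$\|\Delta(x)\|_1\le\frac{1}{(r+1)(n-1)!\,\Gamma(\frac{1}{2\alpha})\Gamma(\beta-\frac{1}{2\alpha})}\left[\sum_{k=1}^{r+1}\binom{r+1}{k}\Gamma\left(\frac{n+k}{2\alpha}\right)\Gamma\left(\beta-\frac{n+k}{2\alpha}\right)\right]\omega_r(f^{(n)},\xi)_1\,\xi^n.$$ Hence $\|\Delta(x)\|_1\to0$ as $\xi\to0$. If additionally $f^{(2m)}\in L_1(\mathbb{R})$ for $m=1,\dots,\lfloor n/2\rfloor$, then $\|M_{r,\xi}(f)-f\|_1\to0$ as $\xi\to0$.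
   Context: For $r\in\mathbb{N}$ and $n\in\mathbb{Z}_+$ set $\alpha_j=(-1)^{r-j}\binom{r}{j}j^{-n}$ for $j=1,\dots,r$ and $\alpha_0=1-\sum_{j=1}^r(-1)^{r-j}\binom{r}{j}j^{-n}$. For $\alpha\in\mathbb{N}$, $\beta>\frac{1}{2\alpha}$, $\xi>0$, let $W=\frac{\Gamma(\beta)\alpha\xi^{2\alpha\beta-1}}{\Gamma(\frac{1}{2\alpha})\Gamma(\beta-\frac{1}{2\alpha})}$ and $M_{r,\xi}(f;x)=W\int_{-\infty}^{\infty}\frac{\sum_{j=0}^r\alpha_jf(x+jt)}{(t^{2\alpha}+\xi^{2\alpha})^{\beta}}dt$, $x\in\mathbb{R}$. Let $\delta_k=\sum_{j=1}^r\alpha_j j^k$ and $$\Delta(x):=M_{r,\xi}(f;x)-f(x)-\sum_{m=1}^{\lfloor n/2\rfloor}\frac{f^{(2m)}(x)\delta_{2m}}{(2m)!}\frac{\Gamma(\frac{2m+1}{2\alpha})\Gamma(\beta-\frac{2m+1}{2\alpha})}{\Gamma(\frac{1}{2\alpha})\Gamma(\beta-\frac{1}{2\alpha})}\xi^{2m}$$ (empty sum if $n=1$). For $g\in L_1(\mathbb{R})$, $\Delta_t^rg(x)=\sum_{j=0}^r(-1)^{r-j}\binom{r}{j}g(x+jt)$ and $\omega_r(g,h)_1=\sup_{|t|\le h}\|\Delta_t^rg(x)\|_{1,x}$, $h>0$. $\|\cdot\|_1$ is the $L_1(\mathbb{R})$ norm in $x$. *)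

(* Defs.v *)
From HB Require Import structures.
From mathcomp Require Import all_boot all_order all_algebra.
From mathcomp Require Import all_classical all_reals all_analysis.
Set Implicit Arguments. Unset Strict Implicit. Unset Printing Implicit Defensive.
Import Order.TTheory GRing.Theory Num.Theory.
Import numFieldNormedType.Exports.
Local Open Scope classical_set_scope.
Local Open Scope ring_scope.

Section Defs.
Variable R : realType.

Definition Gamma (s : R) : R :=
  Rintegral lebesgue_measure `]0%R, +oo[ (fun t => powR t (s - 1) * expR (- t)).

Definition L1norm (g : R -> R) : \bar R :=
  Lnorm lebesgue_measure 1%E (EFin \o g).

Definition Cn (n : nat) (f : R -> R) : Prop :=
  (forall k, (k < n)%N -> forall x, derivable (derive1n k f) x 1) /\
  continuous (derive1n n f).

Definition alphac (r n j : nat) : R :=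
  if j == 0%N then
    1 - \sum_(1 <= i < r.+1) (-1) ^+ (r - i) * 'C(r, i)%:R * (i%:R ^- n)
  else (-1) ^+ (r - j) * 'C(r, j)%:R * (j%:R ^- n).

Definition deltac (r n k : nat) : R :=
  \sum_(1 <= j < r.+1) alphac r n j * j%:R ^+ k.

Definition Wconst (a : nat) (b xi : R) : R :=
  Gamma b * a%:R * powR xi (2 * a%:R * b - 1)
  / (Gamma (1 / (2 * a%:R)) * Gamma (b - 1 / (2 * a%:R))).

Definition Mop (r n a : nat) (b xi : R) (f : R -> R) (x : R) : R :=
  Wconst a b xi *
  Rintegral lebesgue_measure setT
    (fun t => (\sum_(j < r.+1) alphac r n j * f (x + j%:R * t))
              / powR (t ^+ (2 * a) + xi ^+ (2 * a)) b).

Definition Deltaop (r n a : nat) (b xi : R) (f : R -> R) (x : R) : R :=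
  Mop r n a b xi f x - f x
  - \sum_(1 <= m < (n./2).+1)
      (derive1n (2 * m) f x * deltac r n (2 * m) / ((2 * m)`!)%:R
       * (Gamma (((2 * m)%:R + 1) / (2 * a%:R))
          * Gamma (b - ((2 * m)%:R + 1) / (2 * a%:R)))
       / (Gamma (1 / (2 * a%:R)) * Gamma (b - 1 / (2 * a%:R)))
       * xi ^+ (2 * m)).

Definition fdiff (r : nat) (t : R) (g : R -> R) (x : R) : R :=
  \sum_(j < r.+1) (-1) ^+ (r - j) * 'C(r, j)%:R * g (x + j%:R * t).

Definition omega1 (r : nat) (g : R -> R) (h : R) : \bar R :=
  ereal_sup [set L1norm (fdiff r t g) | t in [set t : R | `|t| <= h]].

Definition Cconst (r n a : nat) (b : R) : R :=
  (\sum_(1 <= k < r.+2) 'C(r.+1, k)%:R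
      * Gamma ((n + k)%:R / (2 * a%:R)) * Gamma (b - (n + k)%:R / (2 * a%:R)))
  / ((r.+1)%:R * ((n.-1)`!)%:R * Gamma (1 / (2 * a%:R)) * Gamma (b - 1 / (2 * a%:R))).

End Defs.

(* Main.v *)
Require Import Defs.
From HB Require Import structures.
From mathcomp Require Import all_boot all_order all_algebra.
From mathcomp Require Import all_classical all_reals all_analysis.
From mathcomp Require Import measurable_realfun ring lra.
Import Order.TTheory GRing.Theory Num.Theory.
Import numFieldNormedType.Exports.
Local Open Scope classical_set_scope.
Local Open Scope ring_scope.

(* The coefficients alpha_j are chosen so that the r-fold combination of the
   order-n Taylor remainders of f at x with increments j t equals
     t^n / (n-1)! int_0^1 (1-s)^(n-1) (Delta_{st}^r f^(n))(x) ds.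
   Integrated against the kernel W / (t^(2a) + xi^(2a))^b, the odd Taylor terms
   vanish and the even ones are those subtracted in Delta(x), so Delta(x) is the
   integral of this combination, for almost every x (where Tonelli's theorem
   provides integrability).  The L1 norm in x of the combination is bounded with
   omega_r(h, |u|) <= (1 + |u|/xi)^r omega_r(h, xi), the integral of
   (1 + |t|s/xi)^r over [0,1] is expanded by the binomial formula, and the
   resulting absolute moments of the kernel are Beta integrals. *)

(** * Lebesgue integration on the line *)

Section MeasureBasics.
Context {R : realType}.
Local Notation mu := (@lebesgue_measure R).
Implicit Types (f g : R -> R) (F : R * R -> R).

(** The factor [j ^- n] in [alphac] cancels the power [j ^+ n] that a Taylor remainder with
    increment [j t] carries; only then do the remaining values of the [n]-th derivative carry the
    pure signed binomial weights of a difference of order [r]. Comparing the modulus at [|t| s] with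
    the modulus at [xi] costs a polynomial of degree [r] in [|t|]. Together with the factor
    [t ^+ n], absolute moments of orders [n] to [n + r] occur. The moment of order [p] is finite for
    [p + 1 < 2 a b], and [p = n + r] gives the hypothesis on [b]. The obstacle is that the
    real-valued integral in [Mop] takes a default value wherever its integrand is not integrable, so
    it cannot be split into Taylor terms and remainder at every [x]. For this reason the absolute
    value of the remainder is integrated first, over the plane and in the extended reals: one
    Tonelli estimate yields both integrability for almost every [x] and the final bound. The limits
    need no continuity of the modulus in [xi]: it is at most [2 ^+ r] times the L1 norm of the
    [n]-th derivative, and the factor [xi ^+ n] does the rest. *)

Lemma ge0_integral_shift (c : R) (f : R -> \bar R) :
  measurable_fun [set: R] f -> (forall x, 0 <= f x)%E ->
  (\int[mu]_x f (x + c)%R = \int[mu]_x f x)%E.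
Proof.
move=> mf f0.
pose phi : measurableTypeR R -> measurableTypeR R := fun x : R => x + c.
have mphi : measurable_fun setT phi.
  by apply: measurable_funD => //; exact: measurable_cst.
transitivity (\int[pushforward mu phi]_x f x)%E.
  by rewrite ge0_integral_pushforward.
apply: eq_measure_integral => A mA _.
apply/esym/lebesgue_measure_unique => //= _ [[a b]] _ <-.
rewrite /pushforward.
have -> : (fun x : R => x + c) @^-1` [set` `]a, b]] = [set` `]a - c, b - c]].
  by apply/seteqP; split => x /=; rewrite !in_itv/= ltrBlDr lerBrDr.
rewrite !lebesgue_measure_itv/= !lte_fin ltrD2r; case: ifP => // _.
by rewrite -!EFinD; congr (_%:E); ring.
Qed.

Lemma integral_opp f : mu.-integrable setT (EFin \o f) ->
  (\int[mu]_x (f (- x)%R)%:E = \int[mu]_x (f x)%:E)%E.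
Proof.
move=> /integrableP[mf fi].
have mN : measurable_fun setT (-%R : measurableTypeR R -> measurableTypeR R) by [].
have pf (g : R -> \bar R) :
  (\int[pushforward mu (-%R : measurableTypeR R -> measurableTypeR R)]_x g x =
   \int[mu]_x g x)%E.
  by apply: eq_measure_integral => A mA _; exact: lebesgue_measureN.
have Nf : mu.-integrable setT (EFin \o (f \o -%R)).
  apply/integrableP; split.
    exact: (measurableT_comp mf).
  rewrite -[X in (X < _)%E](@ge0_integral_pushforward _ _ _ _ _ _ mN mu setT
    (fun x => `|(f x)%:E|%E))//; last exact: measurableT_comp.
  by rewrite pf.
by rewrite -[RHS]pf integral_pushforward.
Qed.

Lemma ge0_integral_even (f : R -> R) : measurable_fun [set: R] f ->
  (forall x, 0 <= f x) -> (forall x, f (- x) = f x) ->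
  (\int[mu]_x (f x)%:E = 2%:E * \int[mu]_(x in `]0%R, +oo[) (f x)%:E)%E.
Proof.
move=> mf f0 fN.
have mEf : measurable_fun setT (EFin \o f) by exact/measurable_EFinP.
have mfS D : measurable_fun D (EFin \o f) by exact: measurable_funTS.
have -> : [set: R] = [set` `]-oo, 0%R]] `|` [set` `]0%R, +oo[].
  by apply/seteqP; split => x //= _; rewrite !in_itv/= andbT; case: (leP x 0); [left|right].
rewrite ge0_integral_setU//=; last 3 first.
- exact: mfS.
- by move=> x _; rewrite lee_fin.
- by apply/disj_setPRL => x /=; rewrite !in_itv/= andbT => h /le_lt_trans/(_ h); rewrite ltxx.
have := @ge0_integration_by_substitution0 _ (EFin \o f) mEf (fun r => f0 r).
under [in RHS]eq_integral do rewrite /= fN.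
move=> <-.
by rewrite -integral_itv_obnd_cbnd//= mule_natl mule2n.
Qed.

Lemma tonelli (D1 D2 : set R) (f : R * R -> R) :
  measurable D1 -> measurable D2 -> measurable_fun [set: R * R] f ->
  (forall z, 0 <= f z) ->
  (\int[mu]_(x in D1) \int[mu]_(y in D2) (f (x, y))%:E =
   \int[mu]_(y in D2) \int[mu]_(x in D1) (f (x, y))%:E)%E.
Proof.
move=> mD1 mD2 mf f0.
(* Cutting [f] off by the indicators of both domains reduces the claim to Tonelli on the whole
   plane. *)
pose h := fun z : R * R => (f z * \1_D1 z.1 * \1_D2 z.2)%:E.
have mh : measurable_fun setT h.
  apply/measurable_EFinP; apply: measurable_funM.
    by apply: measurable_funM => //; apply: measurableT_comp => //; exact: measurable_indic.
  by apply: measurableT_comp => //; exact: measurable_indic.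
have h0 z : (0 <= h z)%E by rewrite lee_fin !mulr_ge0.
have := fubini_tonelli (m1 := mu) (m2 := mu) h mh h0.
have E1 x : (\int[mu]_y h (x, y) = (fun x => \int[mu]_(y in D2) (f (x, y))%:E) \_ D1 x)%E.
  rewrite patchE /h /=; case: ifPn => xD.
    rewrite [RHS]integral_mkcond; apply: eq_integral => y _.
    rewrite patchE !indicE xD mulr1; case: (y \in D2); by rewrite ?mulr1 ?mulr0.
  by rewrite integral0_eq// => y _; rewrite indicE (negbTE xD) mulr0 mul0r.
have E2 y : (\int[mu]_x h (x, y) = (fun y => \int[mu]_(x in D1) (f (x, y))%:E) \_ D2 y)%E.
  rewrite patchE /h /=; case: ifPn => yD.
    rewrite [RHS]integral_mkcond; apply: eq_integral => x _.
    rewrite patchE !indicE yD mulr1; case: (x \in D1); by rewrite ?mulr1 ?mulr0.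
  by rewrite integral0_eq// => x _; rewrite [\1_D2 _]indicE (negbTE yD) mulr0.
under eq_integral do rewrite E1.
under [in RHS]eq_integral do rewrite E2.
by rewrite -!integral_mkcond.
Qed.

Lemma measurable_fun_tonelli (D : set R) (f : R * R -> R) : measurable D ->
  measurable_fun [set: R * R] f -> (forall z, 0 <= f z) ->
  measurable_fun [set: R] (fun x => \int[mu]_(y in D) (f (x, y))%:E)%E.
Proof.
move=> mD mf f0; pose h := fun z : R * R => (f z * \1_D z.2)%:E.
rewrite (_ : (fun _ => _) = (fun x => \int[mu]_y h (x, y))%E).
  apply: measurable_fun_fubini_tonelli_F => //.
    apply/measurable_EFinP; apply: measurable_funM => //.
    by apply: measurableT_comp => //; exact: measurable_indic.
  by move=> z; rewrite lee_fin mulr_ge0.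
apply/funext => x; rewrite integral_mkcond; apply: eq_integral => y _.
by rewrite patchE /h /= indicE; case: ifPn; rewrite ?mulr1 ?mulr0.
Qed.

(** The integral is [fine] of a difference of two Tonelli integrals, each measurable in [x], and
    [fine] is measurable on the extended reals. This covers [Mop] also at points where its integral
    diverges. *)
Lemma measurable_fun_Rintegral (D : set R) F : measurable D ->
  measurable_fun [set: R * R] F ->
  measurable_fun setT (fun x => \int[mu]_(y in D) F (x, y))%R.
Proof.
move=> mD mF.
pose h := fun z : R * R => (F z * \1_D z.2)%:E.
have mh : measurable_fun setT h.
  apply/measurable_EFinP; apply: measurable_funM => //.
  by apply: measurableT_comp => //; exact: measurable_indic.
apply: (measurableT_comp (@fine_measurable R _ measurableT)).
rewrite (_ : (fun _ => _) = (fun x => \int[mu]_y (h^\+ (x, y)) - \int[mu]_y (h^\- (x, y)))%E).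
  by apply: emeasurable_funB; apply: measurable_fun_fubini_tonelli_F => //;
     [exact: measurable_funepos|exact: measurable_funeneg].
apply/funext => x; rewrite integral_mkcond integralE; congr (_ - _)%E;
  apply: eq_integral => y _; rewrite (funeposE, funenegE) (funeposE, funenegE) /h patchE/= indicE;
  by case: (y \in D); rewrite ?mulr1 ?mulr0.
Qed.

Lemma integrable_sumR (D : set R) (I : Type) (s : seq I) (f : I -> R -> R) :
  measurable D -> (forall i, mu.-integrable D (EFin \o f i)) ->
  mu.-integrable D (EFin \o (fun x => \sum_(i <- s) f i x)).
Proof.
move=> mD fi.
have := @integrable_sum _ _ _ mu _ mD _ s xpredT (fun i => EFin \o f i) (fun i _ => fi i).
by apply: eq_integrable => // x _ /=; rewrite sumEFin.
Qed.

Lemma Rintegral_sum (D : set R) (I : Type) (s : seq I) (f : I -> R -> R) :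
  measurable D -> (forall i, mu.-integrable D (EFin \o f i)) ->
  (\int[mu]_(x in D) (\sum_(i <- s) f i x) = \sum_(i <- s) \int[mu]_(x in D) f i x)%R.
Proof.
move=> mD fi; elim: s => [|i s ih].
  rewrite big_nil; under eq_Rintegral do rewrite big_nil.
  by rewrite Rintegral_cst// mul0r.
rewrite big_cons -ih -RintegralD//; last exact: integrable_sumR.
by apply: eq_Rintegral => x _; rewrite big_cons.
Qed.

Lemma integrableZlR (D : set R) (k : R) f : measurable D ->
  mu.-integrable D (EFin \o f) ->
  mu.-integrable D (EFin \o (fun x => k * f x)).
Proof.
move=> mD fi; have := @integrableZl _ _ R mu D mD k _ fi.
by apply: eq_integrable => // x _ /=; rewrite EFinM.
Qed.

Lemma ge0_integralZlR (D : set R) (k : R) f : measurable D -> 0 <= k ->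
  measurable_fun [set: R] f -> (forall t, 0 <= f t) ->
  (\int[mu]_(t in D) (k * f t)%:E = k%:E * \int[mu]_(t in D) (f t)%:E)%E.
Proof.
move=> mD k0 mf f0; under eq_integral do rewrite EFinM.
rewrite ge0_integralZl//.
- by apply/measurable_EFinP; exact: measurable_funTS.
- by move=> t _; rewrite lee_fin.
Qed.

(* No integrability is needed, since [fine] sends infinite integrals to 0. *)
Lemma le_normr_Rintegral_integral (D : set R) f : measurable D -> measurable_fun [set: R] f ->
  (`| (\int[mu]_(t in D) f t)%R |%:E <= \int[mu]_(t in D) `|f t|%:E)%E.
Proof.
move=> mD mf; rewrite /Rintegral.
apply: (@le_trans _ _ (`| \int[mu]_(t in D) (f t)%:E |)%E).
  by case: (integral _ _ _) => [z| |] /=; rewrite ?normr0 ?lee_fin ?leey.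
apply: le_abse_integral => //.
by apply/measurable_EFinP; exact: measurable_funTS.
Qed.

End MeasureBasics.

(** * The substitution [y = c * t ^+ q] on the half-line *)

Section PowerSubstitution.
Context {R : realType}.
Local Notation mu := (@lebesgue_measure R).

Lemma is_derive_mulX (c : R) (q : nat) (t : R) :
  is_derive t 1 (fun x : R => c * x ^+ q) (c * (q%:R * t ^+ q.-1)).
Proof.
have -> : (fun x : R => c * x ^+ q) = horner (c *: 'X^q).
  by apply/funext => x; rewrite !hornerE.
by apply: is_derive_eq (is_derive_poly _ t) _; rewrite derivZ derivXn hornerZ hornerMn hornerXn mulr_natl.
Qed.

(** Monotone convergence along growing segments. The endpoints are arbitrary because both sides of a
    substitution use it: the segments [[u n, v n]] and their images under the power map. *)
Lemma integral_exhaust (u v : nat -> R) (G : R -> R) :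
  {homo u : m n / (m <= n)%N >-> n <= m} -> {homo v : m n / (m <= n)%N >-> m <= n} ->
  (forall n, 0 < u n) ->
  (forall y : R, 0 < y -> exists n, u n <= y <= v n) ->
  measurable_fun (`](0:R), +oo[ : set R) G -> (forall y : R, 0 < y -> 0 <= G y) ->
  (\int[mu]_(x in `[u n, v n]) (G x)%:E @[n --> \oo] -->
   \int[mu]_(x in `]0%R, +oo[) (G x)%:E)%E.
Proof.
move=> du iv u0 cover mG G0.
have -> : [set` `]0%R, +oo[] = \bigcup_n [set` `[u n, v n]].
  apply/seteqP; split => x /=; rewrite in_itv/= andbT.
    by move=> /cover[n xn]; exists n => //=; rewrite in_itv.
  by move=> [n _] /=; rewrite in_itv/= => /andP[+ _]; exact: lt_le_trans.
have sub n : [set` `[u n, v n]] `<=` `]0, +oo[.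
  by move=> x /=; rewrite !in_itv/= andbT => /andP[+ _]; exact: lt_le_trans.
apply: ge0_nondecreasing_set_cvg_integral => //.
- move=> m n mn; apply/subsetPset => x /=; rewrite !in_itv/= => /andP[a b].
  by rewrite (le_trans (du _ _ mn) a) (le_trans b (iv _ _ mn)).
- move=> n; apply/measurable_EFinP; apply: measurable_funS mG => //.
- by move=> n x /sub; rewrite /= in_itv/= andbT lee_fin => /G0.
Qed.

(* The substitution theorem for unbounded intervals in the library requires the
   derivative to converge at infinity, hence the exhaustion by segments. *)
Lemma integral_subst_mulX (c : R) (q : nat) (G : R -> R) :
  0 < c -> (0 < q)%N ->
  {in `]0, +oo[, continuous G} -> (forall y : R, 0 < y -> 0 <= G y) ->
  (\int[mu]_(y in `]0%R, +oo[) (G y)%:E =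
   \int[mu]_(t in `]0%R, +oo[) (G (c * t ^+ q) * (c * (q%:R * t ^+ q.-1)))%:E)%E.
Proof.
move=> c0 q0 cG G0.
pose F (t : R) := c * t ^+ q.
have dF t := is_derive_mulX c q t.
have F'E : derive1 F = (fun t => c * (q%:R * t ^+ q.-1)).
  by apply/funext => t; rewrite derive1E; exact: derive_val.
have cF' : continuous (derive1 F).
  move=> t; rewrite F'E; apply: cvgM; first exact: cvg_cst.
  by apply: cvgM; [exact: cvg_cst|exact: exprn_continuous].
have cF : continuous F.
  by move=> t; apply: cvgM; [exact: cvg_cst|exact: exprn_continuous].
have F0 t : 0 < t -> 0 < F t by move=> t0; rewrite mulr_gt0 ?exprn_gt0.
have incF : {in Num.nneg &, {homo F : x y / x < y}}.
  move=> x y x0 y0 xy; rewrite ltr_pM2l// ltr_pXn2r//.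
pose u n : R := n.+1%:R^-1; pose v n : R := n.+1%:R.
have u0 n : 0 < u n by rewrite invr_gt0.
have uv n : u n <= v n.
  by rewrite (@le_trans _ _ 1)// ?invf_le1 ?ler1n.
have du : {homo u : m n / (m <= n)%N >-> n <= m}.
  by move=> m n mn; rewrite lef_pV2 ?posrE// ler_nat ltnS.
have iv : {homo v : m n / (m <= n)%N >-> m <= n}.
  by move=> m n mn; rewrite ler_nat ltnS.
have incF' : {in Num.nneg &, {homo F : x y / x <= y}}.
  move=> x y x0 y0; rewrite le_eqVlt => /predU1P[->//|xy]; apply/ltW.
  exact: incF.
have in0 (w : R) : 0 < w -> w \in Num.nneg by move=> /ltW; rewrite nnegrE.
have mG : measurable_fun (`](0:R), +oo[ : set R) G.
  by apply: open_continuous_measurable_fun => // x; rewrite inE; exact: cG.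
have mH : measurable_fun (`](0:R), +oo[ : set R) (fun t => G (F t) * (derive1 F) t).
  apply: open_continuous_measurable_fun => // x; rewrite inE/= in_itv/= andbT => x0.
  apply: cvgM; last exact: cF'.
  apply: continuous_comp; first exact: cF.
  by apply: cG; rewrite in_itv/= andbT F0.
have H0 t : 0 < t -> 0 <= G (F t) * (derive1 F) t.
  move=> t0; rewrite mulr_ge0 ?G0 ?F0// F'E.
  by rewrite !mulr_ge0 ?exprn_ge0// ltW.
have truncP (y : R) : exists n : nat, y <= n.+1%:R.
  by exists (Num.truncn y); rewrite ltW// truncnS_gt.
have cvgR := @integral_exhaust u v _ du iv u0 _ mH H0.
have cvgL := @integral_exhaust (F \o u) (F \o v) _ _ _ _ _ mG G0.
transitivity (limn (fun n => (\int[mu]_(x in `[(F \o u) n, (F \o v) n]) (G x)%:E)%E)).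
  apply/esym/cvg_lim => //; apply: cvgL.
  - by move=> m n mn /=; rewrite incF' ?in0// du.
  - by move=> m n mn /=; rewrite incF' ?in0// iv.
  - by move=> n /=; rewrite F0.
  (* Since [q >= 1], the [q]-th power of [n.+1] is at least [n.+1], so it suffices that [n.+1]
     dominates both [c / y] and [y / c]. *)
  - move=> y y0; have [n yn] := truncP (Num.max (c / y) (y / c)).
    exists n; move: yn; rewrite ge_max => /andP[n1 n2]; apply/andP; split => /=.
    + rewrite /F /u (@le_trans _ _ (c * n.+1%:R^-1))//.
        rewrite ler_pM2l// exprVn lef_pV2 ?posrE ?exprn_gt0//.
        by rewrite -[leLHS]expr1 ler_weXn2l ?ler1n.
      by rewrite ler_pdivrMr// mulrC -ler_pdivrMr.
    + rewrite /F /v (@le_trans _ _ (c * n.+1%:R))//.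
        by rewrite mulrC -ler_pdivrMr.
      by rewrite ler_pM2l// -[leLHS]expr1 ler_weXn2l ?ler1n.
transitivity (limn (fun n => (\int[mu]_(x in `[u n, v n]) (G (F x) * (derive1 F) x)%:E)%E)).
  congr (limn _); apply/funext => n /=.
  rewrite (@integration_by_substitution_increasing _ F G (u n) (v n))//.
  - move=> x y; rewrite !in_itv/= => /andP[ux _] /andP[uy _] xy.
    by apply: incF => //; rewrite in0// (lt_le_trans (u0 n)).
  - exact: (cvgP _ (cvg_at_right_filter (cF' _))).
  - exact: (cvgP _ (cvg_at_left_filter (cF' _))).
  - split.
    + by move=> x _; have [] := dF x.
    + by apply: cvg_at_right_filter; exact: cF.
    + by apply: cvg_at_left_filter; exact: cF.
  - apply: continuous_in_subspaceT => x; rewrite inE/= in_itv/= => /andP[Fx _].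
    by apply: cG; rewrite in_itv/= andbT (lt_le_trans _ Fx)// F0.
have cvgR' : (forall y : R, 0 < y -> exists n : nat, u n <= y <= v n).
  move=> y y0; have [n yn] := truncP (Num.max y^-1 y).
  exists n; move: yn; rewrite ge_max => /andP[n1 n2]; apply/andP; split => //.
  by rewrite -[leRHS]invrK lef_pV2 ?posrE ?invr_gt0.
have /cvg_lim-> // := cvgR cvgR'.
by apply: eq_integral => t _; rewrite F'E.
Qed.

End PowerSubstitution.

(** * The Gamma function *)

Section GammaFacts.
Context {R : realType}.
Local Notation mu := (@lebesgue_measure R).

Let gam (s : R) := fun t : R => t `^ (s - 1) * expR (- t).

Lemma continuous_powR_gt0 (p x : R) : 0 < x -> {for x, continuous (@powR R ^~ p)}.
Proof.
move=> x0; apply: differentiable_continuous; apply/derivable1_diffP.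
by apply: derivable_powR; rewrite in_itv/= andbT.
Qed.

Lemma continuous_gam s : {in `]0, +oo[, continuous (gam s)}.
Proof.
move=> x; rewrite in_itv/= andbT => x0; apply: cvgM.
  exact: continuous_powR_gt0.
apply: (continuous_comp (f := -%R) (g := expR)); first exact: oppr_continuous.
exact: continuous_expR.
Qed.

Lemma gam_ge0 s t : 0 <= gam s t.
Proof. by rewrite mulr_ge0 ?powR_ge0 ?expR_ge0. Qed.

Lemma measurable_gam s : measurable_fun [set: R] (gam s).
Proof.
apply: measurable_funM; first exact: measurable_powR.
by apply: measurableT_comp => //; exact: measurable_expR.
Qed.

Lemma continuous_expR_half : continuous (fun t : R => expR (- (t / 2))).
Proof.
move=> x; apply: (continuous_comp (f := fun t : R => - (t / 2)) (g := expR)).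
  by apply: cvgN; apply: cvgMl; exact: cvg_id.
exact: continuous_expR.
Qed.

(** This is the integrable majorant behind the finiteness of Gamma: half of the decay of
    [expR (- t)] is kept, the other half absorbs a power of [t]. *)
Lemma integral_expR_half : (\int[mu]_(t in `]0%R, +oo[) (expR (- (t / 2)))%:E = 2%:E)%E.
Proof.
have dE (x : R) : is_derive x 1 (fun t : R => - 2 * expR (- (t / 2))) (expR (- (x / 2))).
  have h : is_derive x 1 (fun t : R => - (t / 2)) (- 2^-1).
    have -> : (fun t : R => - (t / 2)) = horner (- 2^-1 *: 'X).
      by apply/funext => t; rewrite !hornerE; lra.
    by apply: is_derive_eq (is_derive_poly _ x) _; rewrite derivZ derivX !hornerE.
  have h2 : is_derive x 1 (fun t : R => expR (- (t / 2))) _ :=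
    is_derive1_comp (is_derive_expR _) h.
  apply: is_derive_eq (@is_deriveZ _ _ _ _ (- 2) x 1 _ h2) _.
  by rewrite /GRing.scale/=; lra.
have cE := continuous_expR_half.
rewrite integral_itv_obnd_cbnd; last first.
  apply/measurable_EFinP/measurable_funTS; exact: continuous_measurable_fun.
rewrite (@ge0_continuous_FTC2y _ _ (fun t : R => - 2 * expR (- (t / 2))) 0 0).
- by rewrite mul0r oppr0 expR0 mulr1 sub0e -EFinN opprK.
- by move=> x _; exact: expR_ge0.
- exact: continuous_subspaceT.
- have h2 : (t / 2 : R) @[t --> +oo%R] --> +oo%R by apply: gt0_cvgMly => //; exact: cvg_id.
  have h3 : expR (- (t / 2)) @[t --> +oo%R] --> (0 : R) := cvg_comp _ _ h2 (@cvgr_expR R).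
  rewrite -(mulr0 (- 2 : R)); apply: cvgM; first exact: cvg_cst.
  exact: h3.
- by move=> x _; have [] := dE x.
- apply: cvg_at_right_filter; apply: cvgM; first exact: cvg_cst.
  exact: cE.
- by move=> x _; rewrite derive1E; exact: derive_val.
Qed.

(** For [y <= 1] the power is at most 1. For [y > 1] it is at most [y ^+ N.+1], and one term of the
    exponential series at [y / 2] bounds that, at the price of [2 ^+ N.+1] and a factorial. *)
Lemma powR_expR_le (N : nat) (e y : R) : 0 <= e -> e <= N.+1%:R -> 0 < y ->
  y `^ e <= (1 + 2 ^+ N.+1 * (N.+1)`!%:R) * expR (y / 2).
Proof.
move=> e0 eN y0.
have y20 : 0 <= y / 2 by rewrite divr_ge0// ltW.
have E1 : 1 <= expR (y / 2).
  by rewrite -[leLHS](@expR0 R) ler_expR.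
rewrite mulrDl mul1r; have [y1|y1] := leP y 1.
  apply: (@le_trans _ _ 1); last by rewrite (le_trans E1)// lerDl !mulr_ge0 ?exprn_ge0 ?expR_ge0.
  have -> : 1 = 1 `^ e :> R by rewrite powR1.
  by rewrite ge0_ler_powR ?nnegrE ?(ltW y0).
apply: (@le_trans _ _ (y ^+ N.+1)).
  by rewrite -powR_mulrn ?(ltW y0)// ler_powR// ltW.
have := @expR_ge1Dxn R (y / 2) N y20.
rewrite expr_div_n => h.
apply: le_trans (_ : _ <= 2 ^+ N.+1 * (N.+1)`!%:R * expR (y / 2)) _; last by rewrite lerDr expR_ge0.
have F0 : 0 < (N.+1)`!%:R :> R by rewrite ltr0n fact_gt0.
have P0 : 0 < 2 ^+ N.+1 :> R by rewrite exprn_gt0.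
rewrite -ler_pdivrMl ?mulr_gt0//.
apply: le_trans h; rewrite invfM mulrC mulrA.
by rewrite lerDr.
Qed.

(* Substituting [t = y ^+ q] with [q * s >= 1] removes the singularity at 0. *)
Lemma Gamma_lty (s : R) : 0 < s -> (\int[mu]_(t in `]0%R, +oo[) (gam s t)%:E < +oo)%E.
Proof.
move=> s0.
pose q := (Num.truncn s^-1).+1.
have qs : 1 <= q%:R * s.
  by rewrite -ler_pdivrMr// div1r ltW// truncnS_gt.
have e0 : 0 <= q%:R * s - 1 by rewrite subr_ge0.
pose N := Num.truncn (q%:R * s - 1).
have eN : q%:R * s - 1 <= N.+1%:R by rewrite ltW// truncnS_gt.
rewrite (@integral_subst_mulX R 1 q (gam s))//; last 2 first.
- exact: continuous_gam.
- by move=> y _; exact: gam_ge0.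
(* The factor [q] comes from the derivative of [t ^+ q], the bracket from [powR_expR_le], and
   [expR 1] from replacing [expR (- t ^+ q)] by [expR (- t)]. *)
pose C : R := q%:R * (1 + 2 ^+ N.+1 * (N.+1)`!%:R) * expR 1.
have C0 : 0 <= C by rewrite !mulr_ge0 ?addr_ge0 ?mulr_ge0 ?exprn_ge0 ?expR_ge0.
apply: (@le_lt_trans _ _ (\int[mu]_(t in `]0%R, +oo[) (C%:E * (expR (- (t / 2)))%:E))%E).
  apply: ge0_le_integral => //.
  - move=> t; rewrite /= in_itv/= andbT => t0; rewrite lee_fin.
    by rewrite mulr_ge0 ?gam_ge0// !mulr_ge0 ?exprn_ge0 ?(ltW t0).
  - apply/measurable_EFinP; apply: measurable_funM.
      apply: measurable_funTS; apply: (measurableT_comp (measurable_gam s)).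
      by apply: measurable_funM => //; exact: exprn_measurable.
    by apply: measurable_funTS; do 2 apply: measurable_funM => //; exact: exprn_measurable.
  - apply/measurable_EFinP/measurable_funTS; apply: measurable_funM => //.
    exact: continuous_measurable_fun continuous_expR_half.
  move=> t; rewrite /= in_itv/= andbT => t0; rewrite -EFinM lee_fin !mul1r.
  have -> : gam s (t ^+ q) * (q%:R * t ^+ q.-1) = q%:R * (t `^ (q%:R * s - 1)) * expR (- t ^+ q).
    rewrite /gam -powR_mulrn ?(ltW t0)// -powRrM -[t ^+ q.-1]powR_mulrn ?(ltW t0)//.
    have -> : q%:R * s - 1 = q%:R * (s - 1) + q.-1%:R :> R by rewrite /= -natr1; ring.
    rewrite [in RHS]powRD; last by rewrite (gt_eqF t0) implybT.
    ring.
  rewrite /C.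
  have h1 := powR_expR_le _ _ _ e0 eN t0.
  (* The claim is [t <= 1 + t ^+ q]: clear for [t <= 1], while for [t > 1] already [t <= t ^+ q]. *)
  have h2 : expR (- t ^+ q) <= expR 1 * expR (- t).
    rewrite -expRD ler_expR; have [t1|t1] := leP t 1.
      by rewrite (@le_trans _ _ 0) ?oppr_le0 ?exprn_ge0 ?subr_ge0 ?(ltW t0).
    have : t <= t ^+ q by rewrite -[leLHS]expr1 ler_weXn2l// ltW.
    lra.
  have -> : expR (- (t / 2)) = expR (t / 2) * expR (- t) by rewrite -expRD; congr expR; lra.
  rewrite -!mulrA ler_wpM2l//.
  rewrite (@le_trans _ _ (((1 + 2 ^+ N.+1 * (N.+1)`!%:R) * expR (t / 2)) * (expR 1 * expR (- t))))//.
    by apply: ler_pM => //; rewrite ?powR_ge0 ?expR_ge0.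
  by rewrite le_eqVlt; apply/orP; left; apply/eqP; ring.
rewrite ge0_integralZl//; last first.
- apply/measurable_EFinP/measurable_funTS.
  exact: continuous_measurable_fun continuous_expR_half.
by rewrite integral_expR_half -EFinM ltry.
Qed.

Lemma integral_Gamma (s : R) : 0 < s ->
  (\int[mu]_(t in `]0%R, +oo[) (t `^ (s - 1) * expR (- t))%:E = (Gamma s)%:E)%E.
Proof.
move=> s0; rewrite /Gamma /Rintegral fineK// ge0_fin_numE; first exact: Gamma_lty.
by apply: integral_ge0 => t _; rewrite lee_fin (gam_ge0 s).
Qed.

Lemma Gamma_gt0 (s : R) : 0 < s -> 0 < Gamma s.
Proof.
move=> s0; rewrite -lte_fin -integral_Gamma//.
(* A lower bound of the integrand on [[1, 2]]: a power is monotone there, so it is at least the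
   smaller of its values at the two ends. *)
pose m : R := Num.min 1 (2 `^ (s - 1)) * expR (- 2).
have m0 : 0 < m by rewrite mulr_gt0 ?expR_gt0// lt_min ltr01 powR_gt0.
have mg D : measurable_fun D (EFin \o gam s).
  by apply/measurable_EFinP/measurable_funTS; exact: measurable_gam.
apply: (@lt_le_trans _ _ (\int[mu]_(t in `[1%R, 2%R]) (gam s t)%:E)%E); last first.
  apply: ge0_subset_integral => //.
  - exact: mg.
  - by move=> x _; rewrite lee_fin gam_ge0.
  - by move=> x /=; rewrite !in_itv/= andbT => /andP[x1 _]; rewrite (lt_le_trans _ x1).
apply: (@lt_le_trans _ _ (\int[mu]_(t in `[1%R, 2%R]) (cst m%:E t))%E).
  rewrite integral_cst//= lebesgue_measure_itv/= lte_fin ltr1n/= -EFinD -EFinM lte_fin.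
  by rewrite mulr_gt0//; lra.
apply: ge0_le_integral => //.
- by move=> x _; rewrite lee_fin ltW.
- exact: mg.
- move=> x /=; rewrite in_itv/= => /andP[x1 x2].
  rewrite lee_fin /m /gam; apply: ler_pM.
  + by rewrite le_min ler01 powR_ge0.
  + exact: expR_ge0.
  + rewrite ge_min; apply/orP; have [e0|e0] := leP 0 (s - 1).
      by left; rewrite -[leLHS](powRr0 x) ler_powR.
    right; have [e e1] : exists e : R, s - 1 = - e by exists (- (s - 1)); rewrite opprK.
    rewrite e1 !powRN lef_pV2 ?posrE ?powR_gt0// ?(lt_le_trans ltr01 x1)//.
    rewrite ge0_ler_powR ?nnegrE ?(le_trans ler01 x1)//.
    by rewrite -[e]opprK -e1 oppr_ge0 ltW.
  + by rewrite ler_expR lerN2.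
Qed.

Lemma Gamma_ge0 (s : R) : 0 <= Gamma s.
Proof. by apply: Rintegral_ge0 => t _; exact: gam_ge0. Qed.

(** The substitution [y = c * t ^+ q] in the integral defining Gamma at [(p + 1) / q]. The moments
    use it with [q = 1], a Laplace transform, and with [q = 2 * a]. *)
Lemma integral_powR_expR (p c : R) (q : nat) : 0 < p + 1 -> (0 < q)%N -> 0 < c ->
  (\int[mu]_(t in `]0%R, +oo[) (t `^ p * expR (- (c * t ^+ q)))%:E =
   (Gamma ((p + 1) / q%:R) / (q%:R * c `^ ((p + 1) / q%:R)))%:E)%E.
Proof.
move=> p0 q0 c0; set s := (p + 1) / q%:R.
have qN0 : q%:R != 0 :> R by rewrite pnatr_eq0 -lt0n.
have s0 : 0 < s by rewrite divr_gt0// ltr0n.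
have cs0 : 0 < c `^ s by rewrite powR_gt0.
have k0 : 0 < q%:R * c `^ s by rewrite mulr_gt0// ltr0n.
have := integral_Gamma _ s0.
rewrite (@integral_subst_mulX R c q (gam s))//; last 2 first.
- exact: continuous_gam.
- by move=> y _; exact: gam_ge0.
under eq_integral.
  move=> t; rewrite inE/= in_itv/= andbT => t0.
  have -> : gam s (c * t ^+ q) * (c * (q%:R * t ^+ q.-1)) =
     (q%:R * c `^ s) * (t `^ p * expR (- (c * t ^+ q))).
    rewrite /gam powRM ?exprn_ge0 ?(ltW t0)//; last exact: ltW.
    rewrite -{1}[t ^+ q]powR_mulrn ?(ltW t0)// -powRrM.
    have -> : p = q%:R * (s - 1) + q.-1%:R.
      rewrite mulrBr /s mulrC divfK//; case: q q0 {qN0 s s0 cs0 k0} => // q _ /=.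
      by rewrite -natr1; ring.
    rewrite [t `^ (_ + _)]powRD; last by rewrite (gt_eqF t0) implybT.
    rewrite [t `^ (q.-1)%:R]powR_mulrn ?(ltW t0)//.
    rewrite -(@mulr_powRB1 _ c s) ?(ltW c0)//.
    ring.
  rewrite EFinM; over.
rewrite ge0_integralZl//=; last 3 first.
- apply/measurable_EFinP/measurable_funTS; apply: measurable_funM; first exact: measurable_powR.
  apply: (measurableT_comp (@measurable_expR R)); apply: measurable_funN.
  by apply: measurable_funM => //; exact: exprn_measurable.
- by move=> t _; rewrite lee_fin mulr_ge0 ?powR_ge0 ?expR_ge0.
- by rewrite lee_fin ltW.
move=> h.
rewrite [in RHS]mulrC EFinM -h muleA -EFinM mulVf ?gt_eqF// mul1e.
by [].
Qed.

Lemma integral_powR_expR1 (s c : R) : 0 < s -> 0 < c ->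
  (\int[mu]_(u in `]0%R, +oo[) (u `^ (s - 1) * expR (- (c * u ^+ 1)))%:E =
   (Gamma s / c `^ s)%:E)%E.
Proof.
move=> s0 c0; have s1 : 0 < s - 1 + 1 by rewrite subrK.
by rewrite (integral_powR_expR _ _ 1 s1 isT c0) subrK divr1 mul1r.
Qed.

End GammaFacts.

(** * Moments of the kernel *)

Section Moments.
Context {R : realType}.
Local Notation mu := (@lebesgue_measure R).
Variables (a : nat) (b xi : R).
Hypotheses (a0 : (0 < a)%N) (xi0 : 0 < xi).

Definition kern (t : R) : R := (powR (t ^+ (2 * a) + xi ^+ (2 * a)) b)^-1.

Lemma kern_base_gt0 (t : R) : 0 < t ^+ (2 * a) + xi ^+ (2 * a).
Proof. by rewrite ltr_wpDl ?exprn_gt0// exprM exprn_ge0// sqr_ge0. Qed.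

Lemma kern_ge0 t : 0 <= kern t.
Proof. by rewrite invr_ge0 powR_ge0. Qed.

Lemma kernN t : kern (- t) = kern t.
Proof. by rewrite /kern !exprM sqrrN. Qed.

Lemma measurable_kern : measurable_fun [set: R] kern.
Proof.
rewrite (_ : kern = (@powR R ^~ (- b)) \o (fun t => t ^+ (2 * a) + xi ^+ (2 * a))).
  apply: measurableT_comp; first exact: measurable_powR.
  by apply: measurable_funD => //; exact: exprn_measurable.
by apply/funext => t; rewrite /kern /= powRN.
Qed.

Lemma measurable_moment (p : nat) : measurable_fun [set: R] (fun t : R => `|t| ^+ p * kern t).
Proof.
apply: measurable_funM; last exact: measurable_kern.
by apply: measurable_funX; exact: normr_measurable.
Qed.

(* Tonelli applied to [Gamma b * c `^ (- b) = \int u `^ (b - 1) * expR (- c * u)]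
   with [c = t ^+ (2 * a) + xi ^+ (2 * a)]. *)
Lemma integral_moment (p : nat) : p.+1%:R / (2 * a%:R) < b ->
  (\int[mu]_t (`|t| ^+ p * kern t)%:E =
   (xi ^+ p * (Gamma (p.+1%:R / (2 * a%:R)) * Gamma (b - p.+1%:R / (2 * a%:R)))
     / (Gamma b * a%:R * powR xi (2 * a%:R * b - 1)))%:E)%E.
Proof.
move=> pb.
have aR0 : 0 < a%:R :> R by rewrite ltr0n.
have qE : (2 * a)%:R = 2 * a%:R :> R by rewrite natrM.
set s := p.+1%:R / (2 * a%:R).
have s0 : 0 < s by rewrite divr_gt0 ?mulr_gt0.
have b0 : 0 < b by rewrite (lt_trans s0).
have q0 : (0 < 2 * a)%N by rewrite muln_gt0.
rewrite ge0_integral_even; last 3 first.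
- exact: measurable_moment.
- by move=> t; rewrite mulr_ge0 ?kern_ge0 ?exprn_ge0.
- by move=> t; rewrite /= normrN kernN.
have bs0 : 0 < b - s by rewrite subr_gt0.
have X0 : 0 < xi ^+ (2 * a) by rewrite exprn_gt0.
have k0 : 0 <= Gamma s / (2 * a)%:R by rewrite divr_ge0// ltW ?Gamma_gt0.
have p1 : 0 < p%:R + 1 :> R by rewrite natr1.
(* Here [2 a (b - s) = 2 a b - 1 - p], which is how the power of [xi] in [Wconst] arises. *)
have XE : (xi ^+ (2 * a)) `^ (b - s) = powR xi (2 * a%:R * b - 1) / xi ^+ p.
  rewrite -powR_mulrn ?(ltW xi0)// -powRrM -[xi ^+ p]powR_mulrn ?(ltW xi0)//.
  rewrite -powRB ?(gt_eqF xi0) ?implybT//; congr powR.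
  rewrite qE mulrBr /s (mulrC _ (p.+1%:R / _)) divfK ?mulf_neq0 ?(gt_eqF aR0)//.
  by rewrite -natr1; ring.
have P0 : powR xi (2 * a%:R * b - 1) != 0 by rewrite gt_eqF ?powR_gt0.
have Y0 : xi ^+ p != 0 by rewrite gt_eqF ?exprn_gt0.
have GN0 : Gamma b != 0 by rewrite gt_eqF ?Gamma_gt0.
have aN0 : a%:R != 0 :> R by rewrite gt_eqF.
pose f (z : R * R) : R := `|z.1| ^+ p * (z.2 `^ (b - 1) * expR (- ((z.1 ^+ (2 * a) + xi ^+ (2 * a)) * z.2 ^+ 1))).
have mf : measurable_fun setT f.
  apply: measurable_funM; first by apply: measurable_funX; exact: (measurableT_comp (@normr_measurable R setT)).
  apply: measurable_funM; first exact: (measurableT_comp (@measurable_powR R (b - 1)) measurable_snd).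
  apply: (measurableT_comp (@measurable_expR R)); apply: measurable_funN.
  apply: measurable_funM; last exact: measurable_funX.
  by apply: measurable_funD => //; exact: measurable_funX.
have f0 z : 0 <= f z by rewrite !mulr_ge0 ?exprn_ge0 ?powR_ge0 ?expR_ge0.
have mpe (c e : R) (q : nat) : measurable_fun [set: R] (fun y => y `^ e * expR (- (c * y ^+ q))).
  apply: measurable_funM; first exact: measurable_powR.
  apply: (measurableT_comp (@measurable_expR R)); apply: measurable_funN.
  by apply: measurable_funM => //; exact: exprn_measurable.
have T := @tonelli R (`]0%R, +oo[%classic) (`]0%R, +oo[%classic) f (measurable_itv _) (measurable_itv _) mf f0.
have pe0 (c e : R) (q : nat) (y : R) : 0 <= y `^ e * expR (- (c * y ^+ q)).
  by rewrite mulr_ge0 ?powR_ge0 ?expR_ge0.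
(* Integrating over [y] first gives [Gamma b * kern x]. *)
have E1 : (\int[mu]_(x in `]0%R, +oo[) \int[mu]_(y in `]0%R, +oo[) (f (x, y))%:E =
   (Gamma b)%:E * \int[mu]_(t in `]0%R, +oo[) (`|t| ^+ p * kern t)%:E)%E.
  rewrite -(ge0_integralZlR _ _ _ (measurable_itv _) (ltW (Gamma_gt0 _ b0)) (measurable_moment p)); last first.
    by move=> t; rewrite mulr_ge0 ?kern_ge0 ?exprn_ge0.
  apply: eq_integral => t _; rewrite /f /=.
  rewrite (ge0_integralZlR _ _ _ (measurable_itv _) (exprn_ge0 p (normr_ge0 t)) (mpe _ _ _) (pe0 _ _ _)).
  rewrite (integral_powR_expR1 _ _ b0 (kern_base_gt0 t)) -!EFinM; congr EFin.
  rewrite /kern; move: (Gamma b) (powR _ b) (`|t| ^+ p) => G B T'; ring.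
(* In the other order the inner integral is [Gamma s / (2 * a)] times the power [- s] of the outer
   variable; the exponent drops to [b - s - 1], and the outer integral converges because [s < b]. *)
have E2 : (\int[mu]_(y in `]0%R, +oo[) \int[mu]_(x in `]0%R, +oo[) (f (x, y))%:E =
   (Gamma s / (2 * a)%:R)%:E * \int[mu]_(u in `]0%R, +oo[) (u `^ (b - s - 1) * expR (- (xi ^+ (2 * a) * u ^+ 1)))%:E)%E.
  rewrite -(ge0_integralZlR _ _ _ (measurable_itv _) k0 (mpe _ _ _) (pe0 _ _ _)).
  apply: eq_integral => u; rewrite inE/= in_itv/= andbT => u0.
  have l0 : 0 <= u `^ (b - 1) * expR (- (xi ^+ (2 * a) * u)).
    by rewrite mulr_ge0 ?powR_ge0 ?expR_ge0.
  transitivity (\int[mu]_(x in `]0%R, +oo[) ((u `^ (b - 1) * expR (- (xi ^+ (2 * a) * u))) *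
       (x `^ p%:R * expR (- (u * x ^+ (2 * a)))))%:E)%E.
    apply: eq_integral => x; rewrite inE/= in_itv/= andbT => x0.
    rewrite /f /= expr1 (powR_mulrn _ (ltW x0)) (gtr0_norm x0).
    congr EFin; rewrite mulrDl opprD expRD (mulrC u (x ^+ _)); ring.
  rewrite (ge0_integralZlR _ _ _ (measurable_itv _) l0 (mpe _ _ _) (pe0 _ _ _)).
  rewrite (integral_powR_expR _ _ _ p1 q0 u0) natr1 qE -/s -!EFinM expr1.
  have -> : u `^ (b - s - 1) = u `^ (b - 1) / u `^ s.
    rewrite (_ : b - s - 1 = (b - 1) - s); last by ring.
    by rewrite powRB ?(gt_eqF u0) ?implybT.
  congr EFin; rewrite invfM; move: (Gamma s) => G; ring.
have := T; rewrite E1 E2 (integral_powR_expR1 _ _ bs0 X0) -EFinM => h.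
have Gb := Gamma_gt0 _ b0.
have -> : (\int[mu]_(t in `]0%R, +oo[) (`|t| ^+ p * kern t)%:E =
   ((Gamma b)^-1 * (Gamma s / (2 * a)%:R * (Gamma (b - s) / (xi ^+ (2 * a)) `^ (b - s))))%:E)%E.
  by rewrite [in RHS]EFinM -h muleA -EFinM mulVf ?(gt_eqF Gb) ?mul1e.
rewrite -EFinM; congr EFin.
rewrite XE.
rewrite qE; move: (Gamma b) (Gamma s) (Gamma (b - s)) (xi ^+ p) (powR xi _) GN0 Y0 P0.
move=> Gb' G1 G2 Y P GN0 Y0 P0; field.
by rewrite GN0 Y0 P0 aN0.
Qed.

(* The [p]-th absolute moment of the normalized kernel [Wconst * kern]. *)
Definition moment (p : nat) : R := xi ^+ p *
  (Gamma (p.+1%:R / (2 * a%:R)) * Gamma (b - p.+1%:R / (2 * a%:R)))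
  / (Gamma (1 / (2 * a%:R)) * Gamma (b - 1 / (2 * a%:R))).

Lemma Wconst_ge0 : 1 / (2 * a%:R) < b -> 0 <= Wconst a b xi.
Proof.
move=> hb; have aR0 : 0 < a%:R :> R by rewrite ltr0n.
have s0 : 0 < 1 / (2 * a%:R) :> R by rewrite divr_gt0 ?mulr_gt0.
by rewrite /Wconst divr_ge0 ?mulr_ge0 ?powR_ge0 ?ltW ?Gamma_gt0 ?subr_gt0// (lt_trans s0).
Qed.

Lemma integral_Wmoment (p : nat) : p.+1%:R / (2 * a%:R) < b ->
  ((Wconst a b xi)%:E * \int[mu]_t (`|t| ^+ p * kern t)%:E = (moment p)%:E)%E.
Proof.
move=> pb; rewrite integral_moment// -EFinM; congr EFin.
have aR0 : 0 < a%:R :> R by rewrite ltr0n.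
have h1 : 1 / (2 * a%:R) <= p.+1%:R / (2 * a%:R) :> R.
  by rewrite ler_pM2r ?invr_gt0 ?mulr_gt0// ler1n.
have s0 : 0 < 1 / (2 * a%:R) :> R by rewrite divr_gt0 ?mulr_gt0.
have g1 := Gamma_gt0 _ s0.
have g2 : 0 < Gamma (b - 1 / (2 * a%:R)) by rewrite Gamma_gt0// subr_gt0 (le_lt_trans h1).
have g3 : 0 < Gamma b by rewrite Gamma_gt0// (lt_trans s0)// (le_lt_trans h1).
have P0 : powR xi (2 * a%:R * b - 1) != 0 by rewrite gt_eqF ?powR_gt0.
have aN0 : a%:R != 0 :> R by rewrite gt_eqF.
rewrite /Wconst /moment.
move: (Gamma b) (Gamma (1 / _)) (Gamma (b - 1 / _)) (Gamma (p.+1%:R / _)) (Gamma (b - p.+1%:R / _))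
  (powR xi _) P0 g1 g2 g3.
move=> G1 G2 G3 G4 G5 P P0 /lt0r_neq0 g1 /lt0r_neq0 g2 /lt0r_neq0 g3; field.
by rewrite g1 g2 g3 P0 aN0.
Qed.

Lemma integrable_moment (p : nat) : p.+1%:R / (2 * a%:R) < b ->
  mu.-integrable setT (EFin \o (fun t : R => t ^+ p * kern t)).
Proof.
move=> pb; apply/integrableP; split.
  apply/measurable_EFinP/measurable_funM; last exact: measurable_kern.
  exact: exprn_measurable.
under eq_integral do rewrite /= normrM (ger0_norm (kern_ge0 _)) normrX.
by rewrite integral_moment// ltry.
Qed.

Lemma Rintegral_moment_odd (p : nat) : odd p -> p.+1%:R / (2 * a%:R) < b ->
  (\int[mu]_t (t ^+ p * kern t))%R = 0 :> R.
Proof.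
move=> op pb; have ip := integrable_moment _ pb.
have h := integral_opp _ ip.
have : (\int[mu]_t ((-1) * (t ^+ p * kern t)))%R = (\int[mu]_t (t ^+ p * kern t))%R :> R.
  rewrite /Rintegral -h; congr fine; apply: eq_integral => t _.
  by rewrite exprNn kernN -signr_odd op expr1 !mulN1r mulNr.
rewrite (@RintegralZl _ _ _ mu setT _ (-1) measurableT ip) mulN1r => /eqP.
by rewrite eq_sym -addr_eq0 -mulr2n mulrn_eq0/= => /eqP.
Qed.

Lemma Rintegral_Wmoment (p : nat) : p.+1%:R / (2 * a%:R) < b ->
  Wconst a b xi * (\int[mu]_t (t ^+ p * kern t))%R = if odd p then 0 else moment p.
Proof.
move=> pb; case: ifPn => op; first by rewrite Rintegral_moment_odd// mulr0.
apply/EFin_inj; rewrite -integral_Wmoment// EFinM; congr (_ * _)%E.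
have -> : (\int[mu]_t (`|t| ^+ p * kern t)%:E = \int[mu]_t (t ^+ p * kern t)%:E)%E.
  by apply: eq_integral => t _; rewrite -normrX ger0_norm// exprn_even_ge0.
by rewrite /Rintegral fineK//; apply: (integrable_fin_num measurableT); exact: integrable_moment.
Qed.

End Moments.

(** * Taylor remainders *)

Section Taylor.
Context {R : realType}.
Local Notation mu := (@lebesgue_measure R).
Implicit Types (f g : R -> R).

Lemma Cn_derivable n f k x : Cn n f -> (k < n)%N ->
  is_derive x (1 : R) (derive1n k f) (derive1n k.+1 f x).
Proof.
move=> [df _] kn; rewrite /= derive1E; apply: derivableP; exact: df.
Qed.

Lemma Cn_continuous n f k : Cn n f -> (k <= n)%N -> continuous (derive1n k f).
Proof.
move=> [df cf]; rewrite leq_eqVlt => /predU1P[->//|kn] x.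
apply: differentiable_continuous; apply/derivable1_diffP; exact: df.
Qed.

Lemma is_derive_affine (x y s : R) : is_derive s 1 (fun s => x + s * y) y.
Proof.
have -> : (fun s => x + s * y) = horner (x%:P + y *: 'X).
  by apply/funext => t; rewrite !hornerE mulrC.
apply: is_derive_eq (is_derive_poly _ s) _.
by rewrite derivD derivC derivZ derivX !hornerE.
Qed.

Lemma is_derive_onemX (c : R) (k : nat) (s : R) :
  is_derive s 1 (fun s => c * (1 - s) ^+ k) (- (c * (k%:R * (1 - s) ^+ k.-1))).
Proof.
have h : is_derive s (1 : R) (fun s : R => 1 - s) (-1).
  have -> : (fun s : R => 1 - s) = (fun s => 1 + s * (-1)).
    by apply/funext => t; rewrite mulrN1.
  exact: is_derive_affine.
have := @is_derive1_comp _ (fun x => c * x ^+ k) (fun s => 1 - s) s _ _ (is_derive_mulX c k (1 - s)) h.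
by rewrite mulrN1.
Qed.

(** As [s] varies, this sum is the Taylor polynomial based at [x + s * y] and evaluated at [x + y].
    Differentiating in the base point telescopes, and only the top term survives. *)
Lemma is_derive_taylor_sum n f (x y s : R) M : Cn n f -> (M < n)%N ->
  is_derive s 1
    (fun s => \sum_(k < M.+1) derive1n k f (x + s * y) * (y ^+ k / k`!%:R * (1 - s) ^+ k))
    (derive1n M.+1 f (x + s * y) * (y ^+ M.+1 / M`!%:R * (1 - s) ^+ M)).
Proof.
move=> Cf; elim: M => [|M ih] Mn.
  have -> : (fun s => \sum_(k < 1) derive1n k f (x + s * y) * (y ^+ k / k`!%:R * (1 - s) ^+ k))
    = (derive1n 0 f) \o (fun s => x + s * y).
    by apply/funext => t; rewrite big_ord1 /= !expr0 fact0 invr1 !mulr1.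
  apply: is_derive_eq (@is_derive1_comp _ _ (fun s => x + s * y) s _ _ (Cn_derivable _ _ _ _ Cf Mn) (is_derive_affine x y s)) _.
  by rewrite fact0 invr1 expr1 expr0 !mulr1.
have -> : (fun s => \sum_(k < M.+2) derive1n k f (x + s * y) * (y ^+ k / k`!%:R * (1 - s) ^+ k))
    = (fun s => \sum_(k < M.+1) derive1n k f (x + s * y) * (y ^+ k / k`!%:R * (1 - s) ^+ k))
      + ((derive1n M.+1 f) \o (fun s => x + s * y)) * (fun s => y ^+ M.+1 / M.+1`!%:R * (1 - s) ^+ M.+1).
  by apply/funext => t; rewrite big_ord_recr.
have h1 := ih (ltnW Mn).
have h2 := @is_derive1_comp _ _ (fun s => x + s * y) s _ _ (Cn_derivable _ _ _ _ Cf Mn) (is_derive_affine x y s).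
have h3 := is_derive_onemX (y ^+ M.+1 / M.+1`!%:R) M.+1 s.
apply: is_derive_eq (is_deriveD h1 (is_deriveM h2 h3)) _.
have M0 : M`!%:R != 0 :> R by rewrite pnatr_eq0 -lt0n fact_gt0.
have M1 : M.+1%:R != 0 :> R by rewrite pnatr_eq0.
rewrite /GRing.scale /= factS natrM (exprS y M.+1) (exprS (1 - s) M).
move: (derive1 _ _) (derive1 _ _) (y ^+ M.+1) (M`!%:R) (M.+1%:R) ((1 - s) ^+ M) M0 M1.
move=> d1 d2 u v w z v0 w0; field.
by rewrite v0 w0.
Qed.

(* Integrating over [0, 1] instead of [0, y] covers both signs of [y]. *)
Lemma taylor_remainder N f (x y : R) : Cn N.+1 f ->
  f (x + y) - \sum_(k < N.+2) derive1n k f x * (y ^+ k / k`!%:R) =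
  y ^+ N.+1 / N`!%:R *
  (\int[mu]_(s in `[0%R, 1%R])
     ((1 - s) ^+ N * (derive1n N.+1 f (x + s * y) - derive1n N.+1 f x)))%R.
Proof.
move=> Cf; set g := derive1n N.+1 f.
have cg : continuous g by have [] := Cf.
have caff : continuous (fun s : R => x + s * y).
  by move=> s; apply: cvgD; [exact: cvg_cst|apply: cvgMl; exact: cvg_id].
have cphi : continuous (fun s : R => (1 - s) ^+ N * (g (x + s * y) - g x)).
  move=> s; apply: cvgM.
    apply: (continuous_comp (f := fun s : R => 1 - s) (g := fun s => s ^+ N)).
      by apply: cvgB; [exact: cvg_cst|exact: cvg_id].
    exact: exprn_continuous.
  by apply: cvgB; [exact: (continuous_comp (caff s) (cg _))|exact: cvg_cst].
(* The last summand serves to subtract [g x] under the integral. It vanishes at 1, where [F] is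
   [f (x + y)], and at 0 it supplies the Taylor term of order [N.+1]. *)
pose F (s : R) := \sum_(k < N.+1) derive1n k f (x + s * y) * (y ^+ k / k`!%:R * (1 - s) ^+ k)
  + (g x * (y ^+ N.+1 / N.+1`!%:R)) * (1 - s) ^+ N.+1.
have dF (s : R) : is_derive s (1 : R) F (y ^+ N.+1 / N`!%:R * ((1 - s) ^+ N * (g (x + s * y) - g x))).
  have h1 := is_derive_taylor_sum _ _ x y s _ Cf (ltnSn N).
  have h2 := is_derive_onemX (g x * (y ^+ N.+1 / N.+1`!%:R)) N.+1 s.
  apply: is_derive_eq (is_deriveD h1 h2) _.
  have M0 : N`!%:R != 0 :> R by rewrite pnatr_eq0 -lt0n fact_gt0.
  have M1 : N.+1%:R != 0 :> R by rewrite pnatr_eq0.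
  rewrite -/(derive1n N.+1 f) -/g factS natrM /=.
  move: (g _) (g _) (y ^+ N.+1) (N`!%:R) (N.+1%:R) ((1 - s) ^+ N) M0 M1.
  move=> d1 d2 u v w z v0 w0; field.
  by rewrite v0 w0.
have cF : continuous F.
  move=> s; apply: differentiable_continuous; apply/derivable1_diffP.
  by have [] := dF s.
have := @continuous_FTC2 R (fun s => y ^+ N.+1 / N`!%:R * ((1 - s) ^+ N * (g (x + s * y) - g x))) F 0 1 ltr01.
move=> /(_ _ _ _)/wrap[].
- apply: continuous_subspaceT => s; apply: cvgM; [exact: cvg_cst|exact: cphi].
- split.
  + by move=> s _; have [] := dF s.
  + by apply: cvg_at_right_filter; exact: cF.
  + by apply: cvg_at_left_filter; exact: cF.
- by move=> s _; rewrite derive1E; exact: derive_val.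
rewrite -EFinB => /(congr1 fine) /= h.
rewrite -RintegralZl//; last first.
  apply: continuous_compact_integrable; first exact: segment_compact.
  exact: continuous_subspaceT.
rewrite {1}/Rintegral h /F; congr (_ - _).
  rewrite subrr expr0n mulr0 addr0 big_ord_recl big1 => [|i _]; last by rewrite expr0n /= !mulr0.
  by rewrite /= !expr0 fact0 invr1 !mulr1 addr0 mul1r.
rewrite subr0 big_ord_recr/= expr1n mulr1; congr (_ + _).
by apply: eq_bigr => i _; rewrite mul0r addr0 expr1n mulr1.
Qed.

Lemma sum_sign_binom r : (0 < r)%N ->
  \sum_(j < r.+1) (-1) ^+ (r - j) * 'C(r, j)%:R = 0 :> R.
Proof.
move=> r0; have := exprDn (-1 : R) 1 r.
rewrite addNr expr0n gtn_eqF//= => h; rewrite [RHS]h.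
by apply: eq_bigr => j _; rewrite expr1n mulr1 mulr_natr.
Qed.

(** The signed binomial coefficients sum to 0 for [r > 0], so [g x] may be subtracted from every
    value. This matches the differences that [taylor_remainder] produces. *)
Lemma fdiffE r (t : R) g x : (0 < r)%N ->
  fdiff r t g x = \sum_(1 <= j < r.+1) (-1) ^+ (r - j) * 'C(r, j)%:R * (g (x + j%:R * t) - g x).
Proof.
move=> r0; rewrite /fdiff.
transitivity (\sum_(j < r.+1) (-1) ^+ (r - j) * 'C(r, j)%:R * (g (x + j%:R * t) - g x)).
  under [RHS]eq_bigr do rewrite mulrBr.
  by rewrite sumrB -mulr_suml sum_sign_binom// mul0r subr0.
rewrite -(big_mkord xpredT (fun j => (-1) ^+ (r - j) * 'C(r, j)%:R * (g (x + j%:R * t) - g x))).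
by rewrite big_ltn// mul0r addr0 subrr mulr0 add0r.
Qed.

(** The index starts at 1 because for [j = 0] the increment is 0 and the Taylor remainder
    vanishes. *)
Definition remainder r n f (x t : R) : R :=
  \sum_(1 <= j < r.+1) alphac R r n j *
    (f (x + j%:R * t) - \sum_(k < n.+1) derive1n k f x * ((j%:R * t) ^+ k / k`!%:R)).

Lemma remainder_integral r N f (x t : R) : (0 < r)%N -> Cn N.+1 f ->
  remainder r N.+1 f x t =
  t ^+ N.+1 / N`!%:R *
  (\int[mu]_(s in `[0%R, 1%R]) ((1 - s) ^+ N * fdiff r (s * t) (derive1n N.+1 f) x))%R.
Proof.
move=> r0 Cf; set g := derive1n N.+1 f.
have cg : continuous g by have [] := Cf.
pose h (j : nat) (s : R) := (-1) ^+ (r - j) * 'C(r, j)%:R * ((1 - s) ^+ N * (g (x + s * (j%:R * t)) - g x)).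
have ch j : mu.-integrable `[0%R, 1%R] (EFin \o (fun s => (1 - s) ^+ N * (g (x + s * (j%:R * t)) - g x))).
  apply: continuous_compact_integrable; first exact: segment_compact.
  apply: continuous_subspaceT => s; apply: cvgM.
    apply: (continuous_comp (f := fun s : R => 1 - s) (g := fun s => s ^+ N)).
      by apply: cvgB; [exact: cvg_cst|exact: cvg_id].
    exact: exprn_continuous.
  apply: cvgB; last exact: cvg_cst.
  apply: (continuous_comp (f := fun s : R => x + s * (j%:R * t)) (g := g)); last exact: cg.
  by apply: cvgD; [exact: cvg_cst|apply: cvgMl; exact: cvg_id].
have -> : (\int[mu]_(s in `[0%R, 1%R]) ((1 - s) ^+ N * fdiff r (s * t) g x) =
    \int[mu]_(s in `[0%R, 1%R]) (\sum_(j <- index_iota 1 r.+1) h j s))%R.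
  apply: eq_Rintegral => s _; rewrite fdiffE// mulr_sumr; apply: eq_bigr => j _.
  by rewrite /h (mulrCA s); ring.
rewrite Rintegral_sum//; last by move=> j; exact: integrableZlR.
rewrite mulr_sumr /remainder; apply: eq_big_nat => j /andP[j1 _].
rewrite (taylor_remainder N f x (j%:R * t) Cf) RintegralZl//.
have -> : alphac R r N.+1 j = (-1) ^+ (r - j) * 'C(r, j)%:R * j%:R ^- N.+1.
  by rewrite /alphac gtn_eqF.
rewrite -/g exprMn; field.
by rewrite expf_neq0 ?pnatr_eq0 -?lt0n ?fact_gt0.
Qed.

End Taylor.

(** * The L1 modulus of smoothness *)

Section L1.
Context {R : realType}.
Local Notation mu := (@lebesgue_measure R).
Implicit Types (f g h : R -> R).

Lemma L1normE h : (L1norm h = \int[mu]_x `|h x|%:E)%E.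
Proof. by rewrite /L1norm Lnorm1; apply: eq_integral. Qed.

Lemma L1norm_ge0 h : (0 <= L1norm h)%E.
Proof. exact: Lnorm_ge0. Qed.

Lemma measurable_shift (c : R) h : measurable_fun [set: R] h ->
  measurable_fun [set: R] (fun x => h (x + c)).
Proof.
move=> mh; apply: (measurableT_comp mh).
by apply: measurable_funD => //; exact: measurable_cst.
Qed.

Lemma measurable_EFin_norm h : measurable_fun [set: R] h ->
  measurable_fun [set: R] (fun x => `|h x|%:E).
Proof.
by move=> mh; apply/measurable_EFinP; exact: (measurableT_comp (@normr_measurable R setT) mh).
Qed.

Lemma L1norm_shift (c : R) h : measurable_fun [set: R] h ->
  L1norm (fun x => h (x + c)) = L1norm h.
Proof.
move=> mh; rewrite !L1normE.
apply: (@ge0_integral_shift R c (fun x => `|h x|%:E)); last by move=> x; rewrite lee_fin.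
exact: measurable_EFin_norm.
Qed.

Lemma L1normD f g : measurable_fun [set: R] f -> measurable_fun [set: R] g ->
  (L1norm (fun x => f x + g x)%R <= L1norm f + L1norm g)%E.
Proof.
move=> mf mg; rewrite !L1normE -ge0_integralD//; last 2 first.
- exact: measurable_EFin_norm.
- exact: measurable_EFin_norm.
apply: ge0_le_integral => //.
- by apply: measurable_EFin_norm; exact: measurable_funD.
- by apply: emeasurable_funD; exact: measurable_EFin_norm.
- by move=> x _; rewrite lee_fin ler_normD.
Qed.

Lemma L1normZ (c : R) f : measurable_fun [set: R] f ->
  L1norm (fun x => c * f x) = (`|c|%:E * L1norm f)%E.
Proof.
move=> mf; rewrite !L1normE -(ge0_integralZlR _ _ _ measurableT)//.
  by apply: eq_integral => x _; rewrite normrM.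
exact: (measurableT_comp (@normr_measurable R setT)).
Qed.

Lemma L1norm0 : L1norm (fun=> 0 : R) = 0%E.
Proof. by rewrite L1normE integral0_eq// => x _; rewrite normr0. Qed.

Lemma L1norm_sum (I : Type) (s : seq I) (h : I -> R -> R) :
  (forall i, measurable_fun [set: R] (h i)) ->
  (L1norm (fun x => \sum_(i <- s) h i x)%R <= \sum_(i <- s) L1norm (h i))%E.
Proof.
move=> mh; elim: s => [|i s ih].
  rewrite big_nil (_ : (fun _ => _) = (fun=> 0)) ?L1norm0//.
  by apply/funext => x; rewrite big_nil.
rewrite big_cons (_ : (fun _ => _) = (fun x => h i x + \sum_(i <- s) h i x)); last first.
  by apply/funext => x; rewrite big_cons.
apply: (le_trans (L1normD _ _ (mh i) _)); last exact: leeD2l.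
by apply: measurable_sum.
Qed.

Definition diff1 (t : R) g (x : R) := g (x + t) - g x.

Definition shift_sum (m : nat) (t : R) g (x : R) := \sum_(k < m) g (x + k%:R * t).

(** With T the translation by [t], [fdiff r t] is (T - 1)^r; one factor T - 1 is split off, which on
    coefficients is Pascal's rule. *)
Lemma fdiffS r (t : R) g : fdiff r.+1 t g = fdiff r t (diff1 t g).
Proof.
apply/funext => x; rewrite /fdiff /diff1.
under [RHS]eq_bigr do rewrite mulrBr.
rewrite sumrB [X in X - _]big_ord_recr [X in _ - X]big_ord_recl /=.
rewrite big_ord_recl big_ord_recr /= !bin0 !subn0 !binn !subnn.
under eq_bigr => i _.
  rewrite /bump /= add1n subSS binS natrD mulrDr mulrDl.
  over.
rewrite big_split /=.
have E (i : 'I_r) : (-1) ^+ (r - i) * 'C(r, i.+1)%:R * g (x + i.+1%:R * t) =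
  - ((-1) ^+ (r - bump 0 i) * 'C(r, bump 0 i)%:R * g (x + (bump 0 i)%:R * t)).
  rewrite /bump /= add1n -[(r - i)%N]prednK ?subn_gt0// exprS -subnS; ring.
rewrite (eq_bigr _ (fun i _ => E i)) sumrN.
have E2 (i : 'I_r) : (-1) ^+ (r - i) * 'C(r, i)%:R * g (x + i.+1%:R * t) =
  (-1) ^+ (r - i) * 'C(r, i)%:R * g (x + i%:R * t + t).
  by congr (_ * g _); rewrite -natr1; ring.
rewrite (eq_bigr _ (fun i _ => E2 i)) /= /bump /= add1n.
have -> : x + r.+1%:R * t = x + r%:R * t + t by rewrite -natr1; ring.
rewrite mul0r exprS; ring.
Qed.

Lemma diff1_shift_sum (m : nat) (t : R) g :
  diff1 (m%:R * t) g = shift_sum m t (diff1 t g).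
Proof.
apply/funext => x; rewrite /diff1 /shift_sum.
elim: m => [|m ih]; first by rewrite big_ord0 mul0r addr0 subrr.
rewrite big_ord_recr /= -ih.
have -> : x + m.+1%:R * t = x + m%:R * t + t by rewrite -natr1; ring.
ring.
Qed.

Lemma fdiff_shift_sum r m (t : R) g :
  fdiff r t (shift_sum m t g) = shift_sum m t (fdiff r t g).
Proof.
apply/funext => x; rewrite /fdiff /shift_sum exchange_big /=.
apply: eq_bigr => k _; rewrite mulr_sumr; apply: eq_bigr => j _.
by congr (_ * g _); ring.
Qed.

(* With T the translation by [t]: (T^m - 1)^r = (1 + T + ... + T^(m-1))^r (T - 1)^r. *)
Lemma fdiff_mul r m (t : R) g :
  fdiff r (m%:R * t) g = iter r (shift_sum m t) (fdiff r t g).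
Proof.
elim: r g => [|r ih] g /=.
  by apply/funext => x; rewrite /fdiff !big_ord1 !mul0r.
by rewrite fdiffS ih diff1_shift_sum fdiff_shift_sum -iterSr -fdiffS.
Qed.

Lemma measurable_fdiff r (t : R) g : measurable_fun [set: R] g ->
  measurable_fun [set: R] (fdiff r t g).
Proof.
move=> mg; apply: measurable_sum => j; apply: measurable_funM => //.
exact: measurable_shift.
Qed.

Lemma measurable_shift_sum m (t : R) g : measurable_fun [set: R] g ->
  measurable_fun [set: R] (shift_sum m t g).
Proof. by move=> mg; apply: measurable_sum => j; exact: measurable_shift. Qed.

Lemma L1norm_shift_sum m (t : R) g : measurable_fun [set: R] g ->
  (L1norm (shift_sum m t g) <= m%:R%:E * L1norm g)%E.
Proof.
move=> mg; apply: (le_trans (L1norm_sum _ (index_enum 'I_m) (fun k x => g (x + k%:R * t)) _)).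
  by move=> k; exact: measurable_shift.
under eq_bigr do rewrite L1norm_shift//.
by rewrite sumr_const card_ord mule_natl.
Qed.

Lemma L1norm_fdiff_mul r m (t : R) g : measurable_fun [set: R] g ->
  (L1norm (fdiff r (m%:R * t) g) <= (m%:R ^+ r)%:E * L1norm (fdiff r t g))%E.
Proof.
move=> mg; rewrite fdiff_mul; have := measurable_fdiff r t g mg.
move: (fdiff r t g) => h mh.
have step (k : R -> R) : measurable_fun [set: R] k ->
  measurable_fun [set: R] (shift_sum m t k) by exact: measurable_shift_sum.
have mi q : measurable_fun [set: R] (iter q (shift_sum m t) h).
  by elim: q => //= q ih; exact: step.
elim: r => [|r ih] /=; first by rewrite expr0 mul1e.
apply: (le_trans (L1norm_shift_sum _ _ _ (mi r))).
by rewrite exprS EFinM -muleA lee_wpmul2l// lee_fin.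
Qed.

Lemma L1norm_fdiff_le_omega r (xi u : R) g : measurable_fun [set: R] g -> 0 < xi ->
  (L1norm (fdiff r u g) <= ((1 + `|u| / xi) ^+ r)%:E * omega1 r g xi)%E.
Proof.
(* This [m] is large enough for [u / m] to be an admissible step of size at most [xi], and still at
   most [1 + |u| / xi]. *)
move=> mg xi0; pose m := (Num.truncn (`|u| / xi)).+1.
have q0 : 0 <= `|u| / xi by rewrite divr_ge0// ltW.
have m0 : 0 < m%:R :> R by [].
have um : `|u| <= xi * m%:R by rewrite mulrC -ler_pdivrMr// ltW// truncnS_gt.
have m1 : m%:R <= 1 + `|u| / xi by rewrite -nat1r lerD2l truncn_le.
have -> : u = m%:R * (u / m%:R) by rewrite mulrC divfK// gt_eqF.
apply: (le_trans (L1norm_fdiff_mul _ _ _ _ mg)).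
apply: lee_pmul; rewrite ?lee_fin ?exprn_ge0 ?L1norm_ge0//.
  rewrite [m%:R * _]mulrC divfK ?gt_eqF//.
  by rewrite lerXn2r ?nnegrE ?addr_ge0.
apply: ereal_sup_ubound; exists (u / m%:R) => //=.
by rewrite normrM normfV (ger0_norm (ltW m0)) ler_pdivrMr.
Qed.

Lemma omega1_ge0 r g (xi : R) : 0 < xi -> (0 <= omega1 r g xi)%E.
Proof.
move=> xi0; apply: (le_trans (L1norm_ge0 (fdiff r 0 g))).
by apply: ereal_sup_ubound; exists 0 => //=; rewrite normr0 ltW.
Qed.

(** Each of the [r] factors T - 1 at most doubles the norm. For integrable [g] the modulus is thus
    finite, with a bound independent of [xi]. *)
Lemma omega1_le r g (xi : R) : measurable_fun [set: R] g ->
  (omega1 r g xi <= (2 ^+ r)%:E * L1norm g)%E.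
Proof.
move=> mg; apply: ge_ereal_sup => _ [t _ <-].
elim: r g mg => [|r ih] g mg.
  rewrite expr0 mul1e (_ : fdiff 0 t g = g)//.
  by apply/funext => x; rewrite /fdiff big_ord1 expr0 bin0 !mul1r mul0r addr0.
have md : measurable_fun [set: R] (diff1 t g).
  by apply: measurable_funB => //; exact: measurable_shift.
rewrite fdiffS (le_trans (ih _ md))// exprSr EFinM -muleA lee_wpmul2l ?lee_fin ?exprn_ge0//.
have -> : diff1 t g = (fun x => g (x + t) + (-1) * g x).
  by apply/funext => x; rewrite mulN1r.
apply: (le_trans (L1normD _ _ _ _)).
- exact: measurable_shift.
- exact: measurable_funM.
- by rewrite L1norm_shift// L1normZ// normrN1 mul1e mule_natl mule2n.
Qed.

End L1.

(** * The L1 norm of the remainder *)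

Section RemainderBound.
Context {R : realType}.
Local Notation mu := (@lebesgue_measure R).
Variables (r N : nat) (f : R -> R).
Hypotheses (r0 : (0 < r)%N) (Cf : Cn N.+1 f).
Let g := derive1n N.+1 f.

Lemma measurable_derive1n k : (k <= N.+1)%N -> measurable_fun [set: R] (derive1n k f).
Proof. by move=> kN; apply: continuous_measurable_fun; exact: Cn_continuous Cf kN. Qed.

Lemma measurable_shift2 (h : R -> R) (j : R) : measurable_fun [set: R] h ->
  measurable_fun [set: R * R] (fun z => h (z.1 + j * z.2)).
Proof.
move=> mh; apply: (measurableT_comp mh); apply: measurable_funD => //.
by apply: measurable_funM => //; exact: measurable_cst.
Qed.

Lemma measurable_remainder :
  measurable_fun [set: R * R] (fun z => remainder r N.+1 f z.1 z.2).
Proof.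
apply: measurable_sum => j; apply: measurable_funM => //.
apply: measurable_funB.
  exact: (measurable_shift2 f j%:R (measurable_derive1n 0 (leq0n _))).
apply: measurable_sum => k; apply: measurable_funM.
  exact: (measurableT_comp (measurable_derive1n k (ltn_ord k)) measurable_fst).
by apply: measurable_funM => //; apply: measurable_funX; apply: measurable_funM.
Qed.

Lemma measurable_fdiff2 (t : R) (h : R -> R) : measurable_fun [set: R] h ->
  measurable_fun [set: R * R] (fun z => fdiff r (z.2 * t) h z.1).
Proof.
move=> mh; apply: measurable_sum => j; apply: measurable_funM => //.
rewrite (_ : (fun _ => _) = (fun z : R * R => h (z.1 + (j%:R * t) * z.2))).
  exact: measurable_shift2.
by apply/funext => z; congr (h _); ring.
Qed.

(** Termwise integration gives ['C(r, k) / k.+1 = 'C(r.+1, k.+1) / r.+1]: this is the origin of the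
    binomials of row [r.+1] and of the factor [1 / r.+1] in [Cconst]. *)
Lemma integral_binomial (c : R) :
  (\int[mu]_(s in `[0%R, 1%R]) ((1 + c * s) ^+ r)%:E =
   (\sum_(k < r.+1) 'C(r.+1, k.+1)%:R / r.+1%:R * c ^+ k)%:E)%E.
Proof.
(* An antiderivative of the integrand that vanishes at 0; as a polynomial it can be differentiated
   formally. *)
pose P : {poly R} := \sum_(k < r.+1) ('C(r.+1, k.+1)%:R / r.+1%:R * c ^+ k) *: 'X^(k.+1).
pose Q : {poly R} := (1 + c *: 'X) ^+ r.
have PQ : P^`() = Q.
  rewrite /P /Q raddf_sum /= exprDn; apply: eq_bigr => k _.
  rewrite expr1n mul1r derivZ derivXn /= exprZn -scalerMnr -scaler_nat scalerA.
  rewrite -[in RHS]scaler_nat scalerA; congr (_ *: _).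
  have /(congr1 (fun m : nat => m%:R : R)) := mul_bin_diag r.+1 k.
  rewrite /= !natrM => h.
  have -> : 'C(r, k)%:R = k.+1%:R * 'C(r.+1, k.+1)%:R / r.+1%:R :> R.
    by rewrite -h mulrC mulKf.
  ring.
have cP (p : {poly R}) : continuous (horner p).
  by move=> s; apply: differentiable_continuous; apply/derivable1_diffP; exact: derivable_horner.
have QE s : Q.[s] = (1 + c * s) ^+ r by rewrite /Q !hornerE.
under eq_integral do rewrite -QE.
rewrite (@continuous_FTC2 R (horner Q) (horner P) 0 1 ltr01).
- rewrite -EFinB; congr EFin; rewrite /P !horner_sum -sumrB; apply: eq_bigr => k _.
  by rewrite !hornerE expr1n expr0n /= mulr1 mulr0 subr0.
- by apply: continuous_subspaceT; exact: cP.
- split.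
  + by move=> s _; exact: derivable_horner.
  + by apply: cvg_at_right_filter; exact: cP.
  + by apply: cvg_at_left_filter; exact: cP.
- by move=> s _; rewrite -derivE PQ.
Qed.

Lemma L1norm_remainder (xi w t : R) : 0 < xi -> 0 <= w -> omega1 r g xi = w%:E ->
  (L1norm (remainder r N.+1 f ^~ t) <=
   (\sum_(k < r.+1) ('C(r.+1, k.+1)%:R / r.+1%:R / N`!%:R / xi ^+ k * w) * `|t| ^+ (N.+1 + k))%:E)%E.
Proof.
move=> xi0 w0 omw.
have mg : measurable_fun [set: R] g := measurable_derive1n _ (leqnn _).
have mfd2 := measurable_fdiff2 t g mg.
have mafd2 : measurable_fun [set: R * R] (fun z => `|fdiff r (z.2 * t) g z.1|).
  exact: (measurableT_comp (@normr_measurable R setT) mfd2).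
have mfd x : measurable_fun [set: R] (fun s => fdiff r (s * t) g x).
  exact: (measurableT_comp mfd2 (measurable_pair1 x)).
have mX : measurable_fun [set: R] (fun s : R => (1 - s) ^+ N).
  by apply: measurable_funX; apply: measurable_funB.
have k0 : 0 <= `|t| ^+ N.+1 / N`!%:R by rewrite divr_ge0 ?exprn_ge0.
(* The weight [(1 - s) ^+ N] is estimated by 1, so that a pure binomial integral remains after the
   modulus is inserted. *)
have bound x : (`|remainder r N.+1 f x t|%:E <= (`|t| ^+ N.+1 / N`!%:R)%:E *
    \int[mu]_(s in `[0%R, 1%R]) `|fdiff r (s * t) g x|%:E)%E.
  have mprod : measurable_fun [set: R] (fun s => (1 - s) ^+ N * fdiff r (s * t) g x).
    exact: measurable_funM mX (mfd x).
  rewrite (remainder_integral _ _ _ _ _ r0 Cf) -/g normrM normrM normfV normrX.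
  rewrite (ger0_norm (ler0n _ _)) EFinM lee_wpmul2l ?lee_fin//.
  apply: (le_trans (le_normr_Rintegral_integral _ _ (measurable_itv _) mprod)).
  apply: ge0_le_integral => //.
  - by apply: measurable_funTS; exact: measurable_EFin_norm _ mprod.
  - by apply: measurable_funTS; exact: measurable_EFin_norm _ (mfd x).
  move=> s /=; rewrite in_itv/= => /andP[s0 s1]; rewrite lee_fin normrM ler_piMl//.
  by rewrite normrX exprn_ile1// ger0_norm ?subr_ge0// lerBlDr lerDl.
have mJ : measurable_fun [set: R] (fun x => \int[mu]_(s in `[0%R, 1%R]) `|fdiff r (s * t) g x|%:E)%E :=
  measurable_fun_tonelli _ _ (measurable_itv `[0%R, 1%R]) mafd2 (fun z => normr_ge0 _).
have mJ2 : measurable_fun [set: R] (fun s => \int[mu]_x `|fdiff r (s * t) g x|%:E)%E :=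
  measurable_fun_tonelli setT (fun z => `|fdiff r (z.1 * t) g z.2|) measurableT
  (measurableT_comp mafd2 (@measurable_swap _ _ R R)) (fun z => normr_ge0 _).
rewrite L1normE.
apply: (@le_trans _ _ (\int[mu]_x ((`|t| ^+ N.+1 / N`!%:R)%:E *
    \int[mu]_(s in `[0%R, 1%R]) `|fdiff r (s * t) g x|%:E))%E).
  apply: ge0_le_integral => //.
  - apply: measurable_EFin_norm.
    exact: (measurableT_comp measurable_remainder (measurable_pair2 t)).
  - by apply: measurable_funeM; exact: mJ.
rewrite ge0_integralZl; first last.
- by rewrite lee_fin.
- by move=> x _; apply: integral_ge0 => s _; rewrite lee_fin.
- exact: mJ.
- exact: measurableT.
rewrite (tonelli _ _ _ measurableT (measurable_itv _) mafd2 (fun z => normr_ge0 _)) /=.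
apply: (@le_trans _ _ ((`|t| ^+ N.+1 / N`!%:R)%:E *
    \int[mu]_(s in `[0%R, 1%R]) (w * (1 + `|t| / xi * s) ^+ r)%:E))%E.
  apply: lee_wpmul2l; first by rewrite lee_fin.
  apply: ge0_le_integral.
  - exact: measurable_itv.
  - by move=> s _; apply: integral_ge0 => x _; rewrite lee_fin.
  - by apply: measurable_funTS; exact: mJ2.
  - apply/measurable_EFinP/measurable_funTS/measurable_funM => //.
    by apply: measurable_funX; apply: measurable_funD => //; exact: measurable_funM.
  move=> s /=; rewrite in_itv/= => /andP[s0 s1].
  rewrite -L1normE (le_trans (L1norm_fdiff_le_omega _ _ _ _ mg xi0))// omw -EFinM lee_fin.
  by rewrite mulrC normrM (ger0_norm s0) (mulrC s) mulrAC.
have c0 : 0 <= `|t| / xi by rewrite divr_ge0// ltW.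
have -> : (\int[mu]_(s in `[0%R, 1%R]) (w * (1 + `|t| / xi * s) ^+ r)%:E =
    w%:E * \int[mu]_(s in `[0%R, 1%R]) ((1 + `|t| / xi * s) ^+ r)%:E)%E.
  under eq_integral do rewrite EFinM.
  rewrite ge0_integralZl//.
  - apply/measurable_EFinP/measurable_funTS.
    by apply: measurable_funX; apply: measurable_funD => //; exact: measurable_funM.
  - move=> s /=; rewrite in_itv/= => /andP[s0 s1].
    by rewrite lee_fin exprn_ge0// addr_ge0// mulr_ge0.
rewrite integral_binomial -!EFinM lee_fin le_eqVlt; apply/orP; left; apply/eqP.
rewrite mulrA mulr_sumr; apply: eq_bigr => k _.
rewrite exprMn exprVn exprD; ring.
Qed.

End RemainderBound.

(** * Splitting the integrand into Taylor terms and remainder *)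

Section Decomposition.
Context {R : realType}.
Local Notation mu := (@lebesgue_measure R).

Lemma sum_even_terms (F : nat -> R) n :
  \sum_(k < n.+1) (if odd k then 0 else F k) = F 0%N + \sum_(1 <= m < n./2.+1) F (2 * m)%N.
Proof.
elim: n => [|n ih]; first by rewrite big_ord1 /= big_geq ?addr0.
rewrite big_ord_recr /= ih uphalf_half; case: ifPn => on /=.
  by rewrite (negbTE on) addr0 add0n.
move: on; rewrite negbK => on; rewrite on add1n [in RHS]big_nat_recr//= -addrA.
by congr (_ + (_ + F _)); rewrite mul2n doubleS -[in LHS](odd_double_half n) on add1n.
Qed.

(** The zeroth coefficient is defined so that all of them sum to 1, hence [h 0] splits off with
    weight 1. *)
Lemma sum_alphac r n (h : nat -> R) : (0 < r)%N ->
  \sum_(j < r.+1) alphac R r n j * h j =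
  h 0%N + \sum_(1 <= j < r.+1) alphac R r n j * (h j - h 0%N).
Proof.
move=> r0; rewrite -(big_mkord xpredT (fun j => alphac R r n j * h j)) big_ltn//.
under [in RHS]eq_bigr do rewrite mulrBr.
rewrite sumrB -mulr_suml {1}/alphac eqxx.
have -> : \sum_(1 <= i < r.+1) (-1) ^+ (r - i) * 'C(r, i)%:R * (i%:R ^- n) =
  \sum_(1 <= i < r.+1) alphac R r n i.
  by apply: eq_big_nat => i /andP[i1 _]; rewrite /alphac gtn_eqF.
ring.
Qed.

(** Order 0 is separate because [deltac] omits [j = 0]: there the full weight is 1, whereas
    [deltac r n 0] is 1 minus the zeroth coefficient. *)
Definition taylor_coef r n (f : R -> R) (x : R) (k : nat) : R :=
  if k == 0%N then f x else derive1n k f x * deltac R r n k / k`!%:R.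

Lemma sum_alphac_remainder r n (f : R -> R) (x t : R) : (0 < r)%N ->
  \sum_(j < r.+1) alphac R r n j * f (x + j%:R * t) =
  remainder r n f x t + \sum_(k < n.+1) taylor_coef r n f x k * t ^+ k.
Proof.
move=> r0; rewrite (sum_alphac r n (fun j => f (x + j%:R * t)) r0) mul0r addr0.
rewrite /remainder [in RHS]big_ord_recl /= expr0 mulr1 [RHS]addrCA; congr (_ + _).
have -> : \sum_(i < n) taylor_coef r n f x (bump 0 i) * t ^+ bump 0 i =
  \sum_(1 <= j < r.+1) alphac R r n j *
    \sum_(i < n) derive1n i.+1 f x * ((j%:R * t) ^+ i.+1 / i.+1`!%:R).
  under [RHS]eq_bigr do rewrite mulr_sumr.
  rewrite exchange_big /=; apply: eq_bigr => i _.
  rewrite /taylor_coef /bump /= add1n.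
  rewrite (_ : _ / _ * _ = deltac R r n i.+1 * (derive1 (derive1n i f) x / i.+1`!%:R * t ^+ i.+1)); last by ring.
  rewrite /deltac mulr_suml; apply: eq_bigr => j _; rewrite exprMn; ring.
rewrite -big_split /=; apply: eq_bigr => j _.
by rewrite big_ord_recl /= expr0 fact0 invr1 !mulr1; ring.
Qed.

End Decomposition.

(** * The error of the operator *)

Section Main.
Context {R : realType}.
Local Notation mu := (@lebesgue_measure R).
Variables (r N a : nat) (b xi : R) (f : R -> R).
Hypotheses (r0 : (0 < r)%N) (a0 : (0 < a)%N) (xi0 : 0 < xi).
Hypothesis hb : (N.+1 + r + 1)%:R / (2 * a%:R) < b.
Hypothesis Cf : Cn N.+1 f.

Lemma moment_bound p : (p <= N.+1 + r)%N -> p.+1%:R / (2 * a%:R) < b.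
Proof.
move=> pn; apply: le_lt_trans hb.
by rewrite ler_pM2r ?invr_gt0 ?mulr_gt0 ?ltr0n// ler_nat addn1 ltnS.
Qed.

Lemma moment0 : moment a b xi 0 = 1.
Proof.
have s0 : 0 < 1 / (2 * a%:R) :> R by rewrite divr_gt0 ?mulr_gt0 ?ltr0n.
have s1 : 0 < b - 1 / (2 * a%:R) by rewrite subr_gt0; exact: (moment_bound 0 (leq0n _)).
by rewrite /moment expr0 mul1r divff// mulf_neq0// gt_eqF// Gamma_gt0.
Qed.

(** Integrability of the remainder at this [x] is what permits splitting the real-valued integral;
    the monomials are integrable by the hypothesis on [b], and their odd moments vanish. *)
Lemma Mop_remainder x :
  mu.-integrable setT (EFin \o (fun t => remainder r N.+1 f x t * kern a b xi t)) ->
  Mop r N.+1 a b xi f x =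
  Wconst a b xi * (\int[mu]_t (remainder r N.+1 f x t * kern a b xi t))%R +
  \sum_(k < N.+2) (if odd k then 0 else taylor_coef r N.+1 f x k * moment a b xi k).
Proof.
move=> irem.
have imom (k : 'I_N.+2) : mu.-integrable setT (EFin \o (fun t => t ^+ k * kern a b xi t)).
  by apply: integrable_moment => //; apply: moment_bound; exact: (leq_trans (leq_ord k) (leq_addr _ _)).
have imomZ (k : 'I_N.+2) :
    mu.-integrable setT (EFin \o (fun t => taylor_coef r N.+1 f x k * (t ^+ k * kern a b xi t))).
  exact: integrableZlR.
transitivity (Wconst a b xi * (\int[mu]_t (remainder r N.+1 f x t * kern a b xi t +
    \sum_(k < N.+2) taylor_coef r N.+1 f x k * (t ^+ k * kern a b xi t)))%R).
  congr (_ * _); apply: eq_Rintegral => t _.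
  rewrite sum_alphac_remainder// mulrDl; congr (_ + _).
  by rewrite mulr_suml; apply: eq_bigr => k _; rewrite mulrA.
rewrite (RintegralD measurableT irem (integrable_sumR _ _ _ _ measurableT imomZ)) mulrDr.
rewrite (Rintegral_sum _ _ _ _ measurableT imomZ) mulr_sumr; congr (_ + _).
apply: eq_bigr => k _.
rewrite (@RintegralZl _ _ _ mu setT _ _ measurableT (imom k)) mulrCA Rintegral_Wmoment//.
  by case: ifP; rewrite ?mulr0.
by apply: moment_bound; exact: (leq_trans (leq_ord k) (leq_addr _ _)).
Qed.

Lemma Deltaop_remainder x :
  mu.-integrable setT (EFin \o (fun t => remainder r N.+1 f x t * kern a b xi t)) ->
  Deltaop r N.+1 a b xi f x =
  Wconst a b xi * (\int[mu]_t (remainder r N.+1 f x t * kern a b xi t))%R.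
Proof.
move=> irem; rewrite /Deltaop (Mop_remainder _ irem).
rewrite (sum_even_terms (fun k => taylor_coef r N.+1 f x k * moment a b xi k)).
rewrite moment0 mulr1 {1}/taylor_coef eqxx.
set S := (X in _ + (_ + X)); set S' := (X in _ - _ - X).
suff -> : S = S' by ring.
apply: eq_big_nat => m /andP[m1 _].
have m20 : (2 * m == 0)%N = false by rewrite muln_eq0 /= gtn_eqF.
rewrite /taylor_coef m20 /moment natr1.
move: (Gamma _) (Gamma _) (Gamma _) (Gamma _) => G1 G2 G3 G4; ring.
Qed.

Lemma measurable_sum_even (c : nat -> R) :
  measurable_fun [set: R] (fun x => \sum_(1 <= m < (N.+1)./2.+1) c m * derive1n (2 * m) f x).
Proof.
(* [measurable_sum] asks for measurability at every index, even out of range *)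
rewrite (_ : (fun _ => _) =
    (fun x => \sum_(1 <= m < (N.+1)./2.+1) c m * derive1n (minn (2 * m) N.+1) f x)).
  apply: measurable_sum => m; apply: measurable_funM => //.
  exact: (measurable_derive1n N f Cf _ (geq_minr _ _)).
apply/funext => x; apply: eq_big_nat => m /andP[_ mN].
by rewrite (minn_idPl _)// mul2n -geq_half_double.
Qed.

Lemma measurable_Mop : measurable_fun [set: R] (Mop r N.+1 a b xi f).
Proof.
apply: measurable_funM => //.
pose F (z : R * R) := (\sum_(j < r.+1) alphac R r N.+1 j * f (z.1 + j%:R * z.2)) * kern a b xi z.2.
apply: (measurable_fun_Rintegral setT F measurableT).
apply: measurable_funM; last exact: (measurableT_comp (measurable_kern a b xi)).
apply: measurable_sum => j; apply: measurable_funM => //.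
exact: measurable_shift2 (measurable_derive1n N f Cf 0 (leq0n _)).
Qed.

Definition correction_coef (m : nat) : R :=
  deltac R r N.+1 (2 * m) / (2 * m)`!%:R * moment a b xi (2 * m).

Lemma DeltaopE x : Deltaop r N.+1 a b xi f x = Mop r N.+1 a b xi f x - f x
  - \sum_(1 <= m < (N.+1)./2.+1) correction_coef m * derive1n (2 * m) f x.
Proof.
congr (_ - _); apply: eq_bigr => m _.
rewrite /correction_coef /moment natr1.
move: (Gamma _) (Gamma _) (Gamma _) (Gamma _) => G1 G2 G3 G4; ring.
Qed.

Lemma measurable_Deltaop : measurable_fun [set: R] (Deltaop r N.+1 a b xi f).
Proof.
rewrite (funext DeltaopE); apply: measurable_funB; last exact: measurable_sum_even.
apply: measurable_funB; first exact: measurable_Mop.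
exact: (measurable_derive1n N f Cf 0 (leq0n _)).
Qed.

(** Taken in the extended reals, it is meaningful at every [x] and open to Tonelli, unlike the
    signed integral in [Mop]. *)
Let absint x := (\int[mu]_t (`|remainder r N.+1 f x t| * kern a b xi t)%:E)%E.

Let coef (w : R) (k : 'I_r.+1) := 'C(r.+1, k.+1)%:R / r.+1%:R / N`!%:R / xi ^+ k * w.

Let coef_ge0 w k : 0 <= w -> 0 <= coef w k.
Proof. by move=> w0; rewrite /coef !mulr_ge0 ?invr_ge0 ?exprn_ge0 ?(ltW xi0). Qed.

Let bound_k (k : 'I_r.+1) : (N.+1 + k <= N.+1 + r)%N.
Proof. by rewrite leq_add2l leq_ord. Qed.

Let measurable_abs_remainder_kern :
  measurable_fun [set: R * R] (fun z => `|remainder r N.+1 f z.1 z.2| * kern a b xi z.2).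
Proof.
apply: measurable_funM.
  exact: (measurableT_comp (@normr_measurable R setT) (measurable_remainder r N f Cf)).
exact: (measurableT_comp (measurable_kern a b xi)).
Qed.

Let abs_remainder_kern_ge0 z : 0 <= `|remainder r N.+1 f z.1 z.2| * kern a b xi z.2.
Proof. by rewrite mulr_ge0 ?kern_ge0. Qed.

Lemma integral_absint_le w : 0 <= w -> omega1 r (derive1n N.+1 f) xi = w%:E ->
  (\int[mu]_x absint x <=
   \sum_(k < r.+1) (coef w k)%:E * \int[mu]_t (`|t| ^+ (N.+1 + k) * kern a b xi t)%:E)%E.
Proof.
move=> w0 omw.
have mM := measurable_moment a b xi.
have mZM (c : R) p : measurable_fun [set: R] (fun t => (c * (`|t| ^+ p * kern a b xi t))%:E).
  by apply/measurable_EFinP; exact: measurable_funM (measurable_cst c) (mM p).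
have M0 p t : 0 <= `|t| ^+ p * kern a b xi t by rewrite mulr_ge0 ?kern_ge0 ?exprn_ge0.
rewrite /absint (tonelli setT setT _ measurableT measurableT measurable_abs_remainder_kern
  abs_remainder_kern_ge0).
apply: (@le_trans _ _ (\int[mu]_t (\sum_(k < r.+1)
    (coef w k * (`|t| ^+ (N.+1 + k) * kern a b xi t))%:E))%E); last first.
  rewrite ge0_integral_sum; last 3 first.
  - exact: measurableT.
  - by move=> k; exact: mZM.
  - by move=> k t _; rewrite lee_fin mulr_ge0 ?coef_ge0.
  apply: lee_sum => k _.
  by rewrite (ge0_integralZlR _ _ _ measurableT (coef_ge0 _ _ w0) (mM _) (M0 _)).
apply: ge0_le_integral.
- exact: measurableT.
- by move=> t _; apply: integral_ge0 => x _; rewrite lee_fin.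
- exact: (measurable_fun_tonelli setT _ measurableT
    (measurableT_comp measurable_abs_remainder_kern (@measurable_swap _ _ R R)) (fun z => abs_remainder_kern_ge0 _)).
- by apply: emeasurable_sum => k; exact: mZM.
move=> t _ /=.
have mrt : measurable_fun [set: R] (fun x => `|remainder r N.+1 f x t|).
  apply: (measurableT_comp (@normr_measurable R setT)).
  exact: (measurableT_comp (measurable_remainder r N f Cf) (measurable_pair2 t)).
under eq_integral do rewrite mulrC.
rewrite (ge0_integralZlR _ _ _ measurableT (kern_ge0 _ _ _ _) mrt (fun x => normr_ge0 _)) -L1normE.
apply: (@le_trans _ _ ((kern a b xi t)%:E * (\sum_(k < r.+1) coef w k * `|t| ^+ (N.+1 + k))%:E)%E).
  apply: lee_wpmul2l; first by rewrite lee_fin kern_ge0.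
  exact: (L1norm_remainder _ _ _ r0 Cf _ _ _ xi0 w0 omw).
rewrite sumEFin -EFinM lee_fin mulr_sumr le_eqVlt; apply/orP; left; apply/eqP.
by apply: eq_bigr => k _; ring.
Qed.

Lemma ae_integrable_remainder w : 0 <= w -> omega1 r (derive1n N.+1 f) xi = w%:E ->
  {ae mu, forall x, mu.-integrable setT (EFin \o (fun t => remainder r N.+1 f x t * kern a b xi t))}.
Proof.
move=> w0 omw.
pose F (z : R * R) := (remainder r N.+1 f z.1 z.2 * kern a b xi z.2)%:E.
have mF : measurable_fun [set: R * R] F.
  apply/measurable_EFinP; apply: measurable_funM; first exact: measurable_remainder.
  exact: (measurableT_comp (measurable_kern a b xi)).
have iF : (mu \x mu)%E.-integrable setT F.
  apply/integrable12ltyP; first exact: mF.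
  have E x : (\int[mu]_y `|F (x, y)| = absint x)%E.
    by apply: eq_integral => t _; rewrite /F /= normrM (ger0_norm (kern_ge0 _ _ _ _)).
  under eq_integral do rewrite E.
  apply: (le_lt_trans (integral_absint_le _ w0 omw)).
  (* The highest order here is [N.+1 + r], which uses the full strength of the hypothesis on [b]. *)
  under eq_bigr => k _ do rewrite (integral_moment _ _ _ a0 xi0 _ (moment_bound _ (bound_k k))) -EFinM.
  by rewrite sumEFin ltry.
exact: (ae_integrable1 iF).
Qed.

Lemma L1norm_Deltaop_le w : 0 <= w -> omega1 r (derive1n N.+1 f) xi = w%:E ->
  (L1norm (Deltaop r N.+1 a b xi f) <= (Cconst r N.+1 a b * w * xi ^+ N.+1)%:E)%E.
Proof.
move=> w0 omw.
have W0 : 0 <= Wconst a b xi.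
  by apply: Wconst_ge0 => //; exact: (moment_bound 0 (leq0n _)).
have mA : measurable_fun [set: R] absint.
  exact: (measurable_fun_tonelli setT _ measurableT measurable_abs_remainder_kern abs_remainder_kern_ge0).
have A0 x : (0 <= absint x)%E.
  by apply: integral_ge0 => t _; rewrite lee_fin; exact: (abs_remainder_kern_ge0 (x, t)).
rewrite L1normE.
apply: (@le_trans _ _ (\int[mu]_x ((Wconst a b xi)%:E * absint x))%E).
  apply: ae_ge0_le_integral.
  - exact: measurableT.
  - by move=> x _; rewrite lee_fin.
  - exact: measurable_EFin_norm measurable_Deltaop.
  - by move=> x _; apply: mule_ge0; [rewrite lee_fin|exact: A0].
  - by apply: measurable_funeM; exact: mA.
  (* On the null set [Z] the integral of the remainder may take its default value, so the pointwise
     bound is claimed only outside it. *)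
  have [Z [mZ Z0 sZ]] := ae_integrable_remainder _ w0 omw.
  exists Z; split => // x /= nx; apply: sZ => irem; apply: nx => _.
  rewrite (Deltaop_remainder _ irem) normrM (ger0_norm W0) EFinM.
  apply: lee_wpmul2l; first by rewrite lee_fin.
  apply: (le_trans (le_normr_Rintegral_integral setT _ measurableT _)).
    apply: measurable_funM; last exact: measurable_kern.
    exact: (measurableT_comp (measurable_remainder r N f Cf) (measurable_pair1 x)).
  rewrite le_eqVlt; apply/orP; left; apply/eqP; apply: eq_integral => t _.
  by rewrite normrM (ger0_norm (kern_ge0 _ _ _ _)).
rewrite ge0_integralZl; first last.
- by rewrite lee_fin.
- by move=> x _; exact: A0.
- exact: mA.
- exact: measurableT.
apply: le_trans (_ : (_ <= (Wconst a b xi)%:E * \sum_(k < r.+1) (coef w k)%:E *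
    \int[mu]_t (`|t| ^+ (N.+1 + k) * kern a b xi t)%:E)%E) _.
  by apply: lee_wpmul2l; [rewrite lee_fin|exact: integral_absint_le].
rewrite ge0_sume_distrr; last first.
  move=> k _; apply: mule_ge0; first by rewrite lee_fin coef_ge0.
  by apply: integral_ge0 => t _; rewrite lee_fin mulr_ge0 ?kern_ge0 ?exprn_ge0.
under eq_bigr => k _ do
  rewrite muleCA (integral_Wmoment _ _ _ a0 xi0 _ (moment_bound _ (bound_k k))) -EFinM.
rewrite sumEFin lee_fin le_eqVlt; apply/orP; left; apply/eqP.
(* The index [k] here is one less than in [Cconst], since the moment of order [n + k] has Gamma
   arguments with [n + k + 1]. Its factor [xi ^+ k] cancels the division by [xi ^+ k] in [coef],
   leaving [xi ^+ n] in every term. *)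
rewrite /Cconst big_add1 /= big_mkord !mulr_suml; apply: eq_bigr => k _.
have x0 : xi ^+ k != 0 by rewrite expf_neq0 ?gt_eqF.
rewrite /coef /moment -addnS exprD.
rewrite -[RHS]mul1r -[X in _ = X * _](divff x0); move: (Gamma _) (Gamma _) (Gamma _) (Gamma _) => G1 G2 G3 G4.
rewrite !invfM; move: (xi ^+ k) (xi ^+ N.+1) => X Y; ring.
Qed.

Lemma L1norm_MopB_le :
  (L1norm (fun x => Mop r N.+1 a b xi f x - f x)%R <= L1norm (Deltaop r N.+1 a b xi f) +
   \sum_(1 <= m < (N.+1)./2.+1) `|correction_coef m|%:E * L1norm (derive1n (2 * m) f))%E.
Proof.
(* Capping the order at [N.+1] makes [d m] measurable for every [m], as [L1norm_sum] asks, without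
   changing the terms in range. *)
pose d m := derive1n (minn (2 * m) N.+1) f.
have md m : measurable_fun [set: R] (d m) := measurable_derive1n N f Cf _ (geq_minr _ _).
have mcd m : measurable_fun [set: R] (fun x => correction_coef m * d m x).
  exact: measurable_funM (measurable_cst _) (md m).
have dE m : (m < (N.+1)./2.+1)%N -> derive1n (2 * m) f = d m.
  by move=> mN; rewrite /d (minn_idPl _)// mul2n -geq_half_double.
have -> : (fun x => Mop r N.+1 a b xi f x - f x) = (fun x => Deltaop r N.+1 a b xi f x +
    \sum_(1 <= m < (N.+1)./2.+1) correction_coef m * d m x).
  apply/funext => x; rewrite DeltaopE -[LHS](subrK
    (\sum_(1 <= m < (N.+1)./2.+1) correction_coef m * derive1n (2 * m) f x)).
  by congr (_ + _); apply: eq_big_nat => m /andP[_ mN]; rewrite dE.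
have mS : measurable_fun [set: R] (fun x => \sum_(1 <= m < (N.+1)./2.+1) correction_coef m * d m x).
  exact: measurable_sum.
apply: (le_trans (L1normD _ _ measurable_Deltaop mS)); apply: leeD2l.
apply: (le_trans (L1norm_sum _ _ _ mcd)).
rewrite le_eqVlt; apply/orP; left; apply/eqP; apply: eq_big_nat => m /andP[_ mN].
by rewrite (L1normZ _ _ (md m)) dE.
Qed.

End Main.

(** * Convergence as [xi] tends to 0, and the theorem *)

Lemma cvge0_of_le_linear (R : realType) (F : R -> \bar R) (C : R) :
  (forall xi, 0 < xi -> xi <= 1 -> (0 <= F xi)%E /\ (F xi <= (C * xi)%:E)%E) ->
  F @ 0^'+ --> 0%E.
Proof.
move=> FC; apply: (@squeeze_cvge _ _ _ _ (cst 0%E) _ (fun xi => (C * xi)%:E)).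
- near=> xi; apply/andP; apply: FC.
    by near: xi; exact: nbhs_right_gt.
  by near: xi; exact: nbhs_right_le.
- exact: cvg_cst.
- apply/fine_cvgP; split; first exact: nearW.
  rewrite -[X in _ --> X](mulr0 C); apply: cvgM; first exact: cvg_cst.
  by apply: cvg_at_right_filter; exact: cvg_id.
Unshelve. all: by end_near.
Qed.

Lemma L1norm_fin (R : realType) (h : R -> R) :
  lebesgue_measure.-integrable setT (EFin \o h) -> L1norm h = (fine (L1norm h))%:E.
Proof.
move=> /integrableP[_ ih]; rewrite fineK// ge0_fin_numE ?L1norm_ge0//.
by rewrite L1normE.
Qed.

Lemma Cconst_ge0 (R : realType) (r n a : nat) (b : R) : 0 <= Cconst r n a b.
Proof.
rewrite /Cconst divr_ge0 ?mulr_ge0 ?Gamma_ge0//.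
by apply: sumr_ge0 => k _; rewrite !mulr_ge0 ?Gamma_ge0.
Qed.

Theorem theorem2 (R : realType) (r n a : nat) (b : R) (f : R -> R) :
  (0 < r)%N -> (0 < n)%N -> (0 < a)%N ->
  (n + r + 1)%:R / (2 * a%:R) < b ->
  Cn n f ->
  lebesgue_measure.-integrable setT (EFin \o derive1n n f) ->
  (forall xi : R, 0 < xi ->
     (L1norm (Deltaop r n a b xi f)
       <= (Cconst r n a b)%:E * omega1 r (derive1n n f) xi * (xi ^+ n)%:E)%E)
  /\ (fun xi : R => L1norm (Deltaop r n a b xi f)) @ 0^'+ --> 0%E
  /\ ((forall m, (1 <= m <= n./2)%N ->
         lebesgue_measure.-integrable setT (EFin \o derive1n (2 * m) f)) ->
      (fun xi : R => L1norm (fun x => Mop r n a b xi f x - f x)) @ 0^'+ --> 0%E).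
Proof.
move=> r0 n0 a0 hb Cf ig; case: n n0 hb Cf ig => // N _ hb Cf ig.
set g := derive1n N.+1 f.
have mg : measurable_fun [set: R] g := measurable_derive1n N f Cf _ (leqnn _).
pose B := 2 ^+ r * fine (L1norm g).
have omB xi : (omega1 r g xi <= B%:E)%E.
  by rewrite EFinM -(L1norm_fin _ _ ig); exact: omega1_le.
have omE xi : 0 < xi -> omega1 r g xi = (fine (omega1 r g xi))%:E.
  move=> xi0; rewrite fineK// ge0_fin_numE ?omega1_ge0//.
  by rewrite (le_lt_trans (omB xi))// ltry.
have om0 xi : 0 < xi -> 0 <= fine (omega1 r g xi) by move=> xi0; rewrite fine_ge0// omega1_ge0.
have bound xi : 0 < xi -> (L1norm (Deltaop r N.+1 a b xi f) <=
    (Cconst r N.+1 a b * fine (omega1 r g xi) * xi ^+ N.+1)%:E)%E.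
  move=> xi0.
  exact: (L1norm_Deltaop_le _ _ _ _ _ _ r0 a0 xi0 hb Cf _ (om0 _ xi0) (omE _ xi0)).
have C0 := Cconst_ge0 R r N.+1 a b.
(* On []0, 1]] every positive power of [xi] is at most [xi], so one linear bound serves both
   [xi ^+ n] and the factors [xi ^+ (2 * m)]. *)
have X1 (xi : R) m : 0 < xi -> xi <= 1 -> xi ^+ m.+1 <= xi.
  by move=> xi0 xi1; rewrite exprS ler_piMr ?(ltW xi0)// exprn_ile1 ?(ltW xi0).
pose A := Cconst r N.+1 a b * B.
have Dlin xi : 0 < xi -> xi <= 1 -> (L1norm (Deltaop r N.+1 a b xi f) <= (A * xi)%:E)%E.
  move=> xi0 xi1; apply: (le_trans (bound _ xi0)); rewrite lee_fin.
  have wB : fine (omega1 r g xi) <= B by rewrite -lee_fin -omE.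
  apply: ler_pM.
  - exact: (mulr_ge0 C0 (om0 _ xi0)).
  - by rewrite exprn_ge0 ?(ltW xi0).
  - exact: ler_wpM2l C0 _ _ wB.
  - exact: X1.
split; [|split].
- by move=> xi xi0; rewrite (omE _ xi0) -!EFinM; exact: bound.
- apply: (cvge0_of_le_linear R _ A) => xi xi0 xi1.
  by split; [exact: L1norm_ge0|exact: Dlin].
move=> iD.
(* The correction coefficients are homogeneous in [xi] of degree [2 * m], so their values at
   [xi = 1] give the constant. *)
pose S := \sum_(1 <= m < (N.+1)./2.+1) `|correction_coef r N a b 1 m| * fine (L1norm (derive1n (2 * m) f)).
apply: (cvge0_of_le_linear R _ (A + S)) => xi xi0 xi1.
split; first exact: L1norm_ge0.
apply: (le_trans (L1norm_MopB_le _ _ _ _ _ _ Cf)).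
rewrite mulrDl EFinD; apply: leeD; first exact: Dlin.
rewrite /S mulr_suml -sumEFin big_nat_cond [in leRHS]big_nat_cond.
apply: lee_sum => m /andP[/andP[m1 mN] _].
have im : lebesgue_measure.-integrable setT (EFin \o derive1n (2 * m) f) by apply: iD; rewrite m1.
rewrite {1}(L1norm_fin _ _ im) -EFinM lee_fin.
have -> : correction_coef r N a b xi m = correction_coef r N a b 1 m * xi ^+ (2 * m).
  rewrite /correction_coef /moment expr1n.
  move: (Gamma _) (Gamma _) (Gamma _) (Gamma _) => G1 G2 G3 G4; ring.
rewrite normrM mulrAC -!mulrA; apply: ler_wpM2l => //.
apply: ler_wpM2l; first by rewrite fine_ge0 ?L1norm_ge0.
rewrite ger0_norm ?exprn_ge0 ?(ltW xi0)//; case: m m1 {mN im} => // m _.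
by rewrite mulnS; exact: X1.
Qed.
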